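(* In the vicinity of the diagonal, the function $$q(z,w)=q^{2(\tau-\phi)(z,w)}\;\frac{1+\psi_+G}{1+\psi_-G}(z,w)$$ vanishes for $z=q^{-\partial}w$, and its inverse $q(z,w)^{-1}$ vanishes for $z=q^{\partial}w$.
   Context: $X$ is a smooth connected compact complex curve, $\omega$ a nonzero meromorphic differential on $X$, $S\subset X$ a finite set containing all zeros and poles of $\omega$. $\mathcal{K}_s$ is the local (Laurent series) field at $s$, $\mathcal{K}=\bigoplus_{s\in S}\mathcal{K}_s$, with bilinear form $\langle f,g\rangle=\sum_{s\in S}\mathrm{res}_s(fg\omega)$ and derivation $\partial f=df/\omega$. $R\subset\mathcal{K}$ is the ring of meromorphic functions on $X$ regular outside $S$ (embedded by Laurent expansions). $\Lambda\subset\mathcal{K}$ is a maximal isotropic complement of $R$, commensurable with $\bigoplus_s\mathcal{O}_s$ ($\mathcal{O}_s$ the completed local ring at $s$). $(e^i)_{i\ge0}$ and $(e_i)_{i\ge0}$ are bases of $R$ and $\Lambda$, dual in the sense $\langle e^i,e_j\rangle=-\delta_{ij}$, with $e_i\to0$. $G=\sum_i e^i\otimes e_i$ (first factor: variable $z$, second factor: variable $w$). It is known that $\gamma=(\partial\otimes1)G-G^2\in R\otimes R$, and that $(f\otimes 1-1\otimes f)G\in\bigoplus_{s,t}\mathbb{C}((z_s,w_t))$ for $f\in\mathcal K$, where $\mathbb{C}((z,w))=\mathbb{C}[[z,w]][z^{-1},w^{-1}]$. $\hbar$ is a formal variable and $q=e^{\hbar}$. For free variables $(\gamma_i)_{i\ge0}$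 and $D=\sum_i\gamma_{i+1}\partial/\partial\gamma_i$, let $\psi,\varphi\in\hbar\,\mathbb{C}[\gamma_i][[\hbar]]$ be the solutions of $\partial_\hbar\psi=D\psi-1-\gamma_0\psi^2$ and $\partial_\hbar\varphi=D\varphi-\gamma_0\psi$. Put $\psi_\pm=\psi(\pm\hbar,(\partial^i\otimes1)\gamma)\in\hbar(R\otimes R)[[\hbar]]$ and $\phi=\frac1{2\hbar}\bigl[\varphi(\hbar,(\partial^i\otimes1)\gamma)-\varphi(-\hbar,(\partial^i\otimes1)\gamma)\bigr]\in(R\otimes R)[[\hbar]]$. With $T=\frac{\sinh(\hbar\partial)}{\hbar\partial}$, $\tau$ is any element of $(R\otimes R)[[\hbar]]$ such that $\tau+\tau^{(21)}=\sum_i(Te^i\otimes e_i-e^i\otimes Te_i)$, where $a^{(21)}(z,w)=a(w,z)$. The factor $q^{2(\tau-\phi)}=e^{2\hbar(\tau-\phi)}$ is an invertible element of $(R\otimes R)[[\hbar]]$. ''In the vicinity of the diagonal'' means: take $s\in S$, $z=z_s$ and $w=w_s$ two copies of a local coordinate at $s$, and consider $(s,s)$-components. There $q(z,w)$ is the quotient of $q^{2(\tau-\phi)}(z-w)(1+\psi_+G)$ by $(z-w)(1+\psi_-G)$, both in $\mathbb{C}((z,w))[[\hbar]]$. The values at $z=q^{\pm\partial}w=\sum_k\frac{(\pm\hbar)^k}{k!}\partial^kw$ are obtained by substituting this series for $z$ in numerator and denominator (giving elements of $\mathbb{C}((w))[[\hbar]]$) and forming the quotient in the fraction field $\mathbb{C}((w))((\hbar))$.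 *)

(* Defs.v *)
From HB Require Import structures.
From mathcomp Require Import all_boot all_order all_algebra finmap zify.
From mathcomp Require Import all_classical all_reals topology normedtype.
From mathcomp Require Import sequences derive complex.
From mathcomp.multinomials Require Import -(notations) monalg.

Set Implicit Arguments.
Unset Strict Implicit.
Unset Printing Implicit Defensive.

Import Order.TTheory GRing.Theory Num.Theory.
Import numFieldNormedType.Exports.

Local Open Scope classical_set_scope.
Local Open Scope ring_scope.

Record fps (A : Type) := Fps { fcoef :> nat -> A }.

HB.instance Definition _ (A : Type) := gen_eqMixin (fps A).
HB.instance Definition _ (A : Type) := gen_choiceMixin (fps A).

Lemma fpsP (A : Type) (u v : fps A) : u =1 v -> u = v.
Proof. by case: u => u; case: v => v /= uv; congr Fps; apply/funext. Qed.

Definition fmap_fps (A B : Type) (f : A -> B) (u : fps A) : fps B :=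
  Fps (fun n => f (u n)).

Section FpsRing.
Variable A : comNzRingType.
Implicit Types u v w : fps A.

Definition fzero : fps A := Fps (fun=> 0).
Definition fopp u : fps A := Fps (fun n => - u n).
Definition fadd u v : fps A := Fps (fun n => u n + v n).
Definition fconst (a : A) : fps A := Fps (fun n => if n == 0 then a else 0).
Definition fmul u v : fps A := Fps (fun n => \sum_(i < n.+1) u i * v (n - i)%N).
Definition fX : fps A := Fps (fun n => (n == 1)%:R).

Fact faddA : associative fadd.
Proof. by move=> u v w; apply: fpsP => n /=; rewrite addrA. Qed.
Fact faddC : commutative fadd.
Proof. by move=> u v; apply: fpsP => n /=; rewrite addrC. Qed.
Fact fadd0 : left_id fzero fadd.
Proof. by move=> u; apply: fpsP => n /=; rewrite add0r. Qed.
Fact faddN : left_inverse fzero fopp fadd.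
Proof. by move=> u; apply: fpsP => n /=; rewrite addNr. Qed.

HB.instance Definition _ :=
  GRing.isZmodule.Build (fps A) faddA faddC fadd0 faddN.

Lemma fmulE u v n : fmul u v n = \sum_(i < n.+1) u i * v (n - i)%N.
Proof. by []. Qed.

Definition ftrunc N u : {poly A} := \poly_(i < N.+1) u i.

Lemma ftruncE N u i : (i <= N)%N -> (ftrunc N u)`_i = u i.
Proof. by move=> iN; rewrite coef_poly ltnS iN. Qed.

Lemma ftruncM N u v n : (n <= N)%N ->
  fmul u v n = (ftrunc N u * ftrunc N v)`_n.
Proof.
move=> nN; rewrite coefM fmulE; apply: eq_bigr => i _.
by rewrite !ftruncE // (leq_trans _ nN) // ?leq_subr // -ltnS.
Qed.

Fact fmulA : associative fmul.
Proof.
move=> u v w; apply: fpsP => n.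
transitivity ((ftrunc n u * (ftrunc n v * ftrunc n w))`_n).
  rewrite coefM fmulE; apply: eq_bigr => i _.
  by rewrite (@ftruncM n) ?leq_subr // ftruncE // -ltnS.
rewrite mulrA coefM fmulE; apply: eq_bigr => i _.
by rewrite -ftruncM ?ftruncE ?leq_subr // -ltnS.
Qed.
Fact fmulC : commutative fmul.
Proof.
by move=> u v; apply: fpsP => n; rewrite !(@ftruncM n) // mulrC.
Qed.
Fact fmul1 : left_id (fconst 1) fmul.
Proof.
move=> u; apply: fpsP => n /=.
rewrite big_ord_recl /= mul1r subn0 big1 ?addr0 // => i _.
by rewrite mul0r.
Qed.
Fact fmulD : left_distributive fmul fadd.
Proof.
move=> u v w; apply: fpsP => n /=; rewrite -big_split /=.
by apply: eq_bigr => i _; rewrite mulrDl.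
Qed.
Fact f1_neq0 : fconst 1 != fzero.
Proof. by apply/eqP => /(congr1 (fun u => fcoef u 0)) /eqP; rewrite oner_eq0. Qed.

HB.instance Definition _ := GRing.Zmodule_isComNzRing.Build (fps A)
  fmulA fmulC fmul1 fmulD f1_neq0.

Lemma fcoefD u v n : (u + v) n = u n + v n. Proof. by []. Qed.
Lemma fcoefN u n : (- u) n = - u n. Proof. by []. Qed.
Lemma fcoefB u v n : (u - v) n = u n - v n. Proof. by []. Qed.
Lemma fcoef0 n : (0 : fps A) n = 0. Proof. by []. Qed.
Lemma fcoef1 n : (1 : fps A) n = if n == 0 then 1 else 0. Proof. by []. Qed.
Lemma fcoefM u v n : (u * v) n = \sum_(i < n.+1) u i * v (n - i)%N.
Proof. by []. Qed.
Lemma fcoef_sum (I : Type) (r : seq I) (P : pred I) (F : I -> fps A) n :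
  (\sum_(i <- r | P i) F i) n = \sum_(i <- r | P i) F i n.
Proof. by apply: (big_morph (fun u : fps A => u n)). Qed.

Lemma fcoefX_lt u k n : u 0 = 0 -> (n < k)%N -> (u ^+ k) n = 0.
Proof.
move=> u0; elim: k n => // k IHk n nk; rewrite exprS fcoefM big1 // => i _.
case: (posnP i) => [->|i_gt0]; first by rewrite u0 mul0r.
rewrite IHk ?mulr0 //; apply: leq_trans (nk : (n <= k)%N).
by rewrite ltn_subrL i_gt0 (leq_trans i_gt0) // -ltnS.
Qed.

Definition fderiv u : fps A := Fps (fun n => u n.+1 *+ n.+1).

(* u(-X) *)
Definition fcompN u : fps A := Fps (fun n => (-1) ^+ n * u n).

(* u / X, meant for u with zero constant term *)
Definition fdivX u : fps A := Fps (fun n => u n.+1).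

End FpsRing.

Section FpsUnit.
Variable A : comUnitRingType.
Implicit Types u v : fps A.

Definition funit u := u 0 \is a GRing.unit.

Lemma finv_ex u : funit u -> exists v, v * u = 1.
Proof.
move=> uu; pose a := 1 - fconst (u 0)^-1 * u.
have a0 : a 0 = 0.
  by rewrite fcoefB fcoef1 fcoefM big_ord_recl big_ord0 /= mulVr // addr0 subrr.
pose g : fps A := Fps (fun n => \sum_(k < n.+1) (a ^+ k) n).
have gE N n : (n <= N)%N -> g n = (\sum_(k < N.+1) a ^+ k) n.
  move=> nN; rewrite fcoef_sum /=.
  rewrite (big_ord_widen N.+1 (fun k => (a ^+ k) n)) ?ltnS // big_mkcond /=.
  apply: eq_bigr => k _; case: ifPn => //; rewrite -leqNgt => nk.
  by rewrite fcoefX_lt.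
exists (g * fconst (u 0)^-1); rewrite -mulrA.
have -> : fconst (u 0)^-1 * u = 1 - a by rewrite /a subKr.
apply: fpsP => n; rewrite fcoefM.
transitivity (((\sum_(k < n.+1) a ^+ k) * (1 - a)) n).
  by rewrite fcoefM; apply: eq_bigr => i _; rewrite (gE n) // -ltnS.
by rewrite mulrC -(opprB a) mulNr -subrX1 opprB fcoefB fcoefX_lt // subr0.
Qed.

Definition finv u : fps A :=
  if pselect (exists v, v * u = 1) is left e then projT1 (cid e) else u.

Fact fmulV : {in funit, left_inverse 1 finv *%R}.
Proof.
move=> u uu; rewrite /finv; case: pselect => [e|[]]; first exact: (projT2 (cid e)).
exact: finv_ex.
Qed.
Fact funitPl u v : v * u = 1 -> funit u.
Proof.
move=> /(congr1 (fun w : fps A => w 0)).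
rewrite fcoefM big_ord_recl big_ord0 addr0 subn0 /= => vu.
by apply/unitrP; exists (v 0); rewrite [u 0 * _]mulrC vu.
Qed.
Fact finv_out : {in [predC funit], finv =1 id}.
Proof.
move=> u nu; rewrite /finv; case: pselect => // -[v vu].
by case/negP: nu; apply: funitPl vu.
Qed.

HB.instance Definition _ :=
  GRing.ComNzRing_hasMulInverse.Build (fps A) fmulV funitPl finv_out.

(* exp(u), meant for u with zero constant term and A of characteristic 0 *)
Definition fexp u : fps A :=
  Fps (fun n => \sum_(k < n.+1) (u ^+ k) n / k`!%:R).

End FpsUnit.

Definition lbounded (A : nmodType) (u : int -> A) :=
  exists N : int, forall n, n < N -> u n = 0.

Record laurent (A : nmodType) :=
  Laurent { lcoef :> int -> A; lcoefP : lbounded lcoef }.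

HB.instance Definition _ (A : nmodType) := gen_eqMixin (laurent A).
HB.instance Definition _ (A : nmodType) := gen_choiceMixin (laurent A).

Lemma laurentP (A : nmodType) (u v : laurent A) : u =1 v -> u = v.
Proof.
case: u v => u uP [v vP] /= uv.
have {}uv : u = v by apply/funext.
by case: _ / uv vP => vP; congr Laurent; apply: Prop_irrelevance.
Qed.

Fact lbounded0 (A : nmodType) : lbounded (fun=> 0 : A).
Proof. by exists 0. Qed.

(* The Laurent series with the given coefficients; it is 0 when these do not  *)
(* vanish for all sufficiently negative exponents.                           *)
Definition lau_of (A : nmodType) (u : int -> A) : laurent A :=
  if pselect (lbounded u) is left uP then Laurent uP
  else Laurent (@lbounded0 A).

Lemma lau_ofE (A : nmodType) (u : int -> A) : lbounded u -> lau_of u =1 u.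
Proof. by rewrite /lau_of; case: pselect. Qed.

Definition lmap (A B : nmodType) (f : A -> B) (u : laurent A) : laurent B :=
  lau_of (fun n => f (u n)).

Lemma lmapE (A B : nmodType) (f : A -> B) (u : laurent A) n :
  f 0 = 0 -> lmap f u n = f (u n).
Proof.
move=> f0; rewrite lau_ofE //; have [N uN] := lcoefP u.
by exists N => m /uN ->.
Qed.

Section LaurentRing.
Variable A : comNzRingType.
Implicit Types (u v w : laurent A) (f g : fps A).

Fact lopp_subproof u : lbounded (fun n => - u n).
Proof. by have [N uN] := lcoefP u; exists N => n /uN ->; rewrite oppr0. Qed.
Fact ladd_subproof u v : lbounded (fun n => u n + v n).
Proof.
have [[N uN] [M vM]] := (lcoefP u, lcoefP v).
exists (Num.min N M) => n; rewrite lt_min => /andP[/uN -> /vM ->].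
by rewrite addr0.
Qed.

Definition lzero : laurent A := Laurent (@lbounded0 A).
Definition lopp u : laurent A := Laurent (lopp_subproof u).
Definition ladd u v : laurent A := Laurent (ladd_subproof u v).

Fact laddA : associative ladd.
Proof. by move=> u v w; apply: laurentP => n /=; rewrite addrA. Qed.
Fact laddC : commutative ladd.
Proof. by move=> u v; apply: laurentP => n /=; rewrite addrC. Qed.
Fact ladd0 : left_id lzero ladd.
Proof. by move=> u; apply: laurentP => n /=; rewrite add0r. Qed.
Fact laddN : left_inverse lzero lopp ladd.
Proof. by move=> u; apply: laurentP => n /=; rewrite addNr. Qed.

HB.instance Definition _ :=
  GRing.isZmodule.Build (laurent A) laddA laddC ladd0 laddN.

(* X^N f *)
Definition lmono_fps (N : int) f (n : int) : A :=
  if 0 <= n - N then f `|n - N|%N else 0.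

Fact lshift_subproof N f : lbounded (lmono_fps N f).
Proof.
exists N => n nN; rewrite /lmono_fps ifN // -ltNge subr_lt0 //.
Qed.

Definition lshift N f : laurent A := Laurent (lshift_subproof N f).

Lemma lshift_bound u N : (forall n, n < N -> u n = 0) -> exists f, u = lshift N f.
Proof.
move=> uN; exists (Fps (fun k => u (N + k%:Z))).
apply: laurentP => n /=; rewrite /lmono_fps /=; case: ifPn => [nN|].
  by rewrite gez0_abs // addrCA subrr addr0.
by rewrite -ltNge subr_lt0 => /uN.
Qed.

Lemma lshift_ex u : exists N f, u = lshift N f.
Proof. by have [N /lshift_bound[f ->]] := lcoefP u; exists N, f. Qed.

Definition lmul_coef u v (n : int) : A :=
  \sum_(i \in [set: int]) u i * v (n - i).

Lemma lmul_shift N M f g :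
  lmul_coef (lshift N f) (lshift M g) =1 lmono_fps (N + M) (f * g).
Proof.
move=> n; rewrite /lmul_coef /lmono_fps.
case: ifPn => [|nNM]; last first.
  rewrite fsbig1 // => i _ /=; rewrite /lmono_fps.
  case: ifPn => [Ni|]; last by rewrite mul0r.
  rewrite [X in _ * X]ifN ?mulr0 //; apply: contra nNM => Mi.
  by have := addr_ge0 Ni Mi; congr (0 <= _); lia.
move nE: (n - (N + M)) => [k|//] _.
pose r := [seq N + i%:Z | i <- index_iota 0 k.+1].
rewrite (@fsbigE _ _ _ _ _ r) //; last first.
- move=> i _ /= ir; rewrite /lmono_fps.
  case: ifPn => [Ni|]; last by rewrite mul0r.
  rewrite [X in _ * X]ifN ?mulr0 //; apply: contra ir => Mi.
  apply/mapP; exists `|(i - N)%R|%N; last lia.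
  by rewrite mem_index_iota; lia.
- by rewrite map_inj_uniq ?iota_uniq // => i j /addrI [].
rewrite big_mkcond big_map big_mkord fcoefM.
apply: eq_bigr => i _; rewrite in_setT /= /lmono_fps.
have ik := ltn_ord i.
rewrite !ifT; [|lia|lia].
by congr (f _ * g _); lia.
Qed.

Fact lmul_subproof u v : lbounded (lmul_coef u v).
Proof.
have [N [f ->]] := lshift_ex u; have [M [g ->]] := lshift_ex v.
by have -> := funext (lmul_shift N M f g); apply: lshift_subproof.
Qed.

Definition lmul u v : laurent A := Laurent (lmul_subproof u v).

Lemma lmulE N M f g : lmul (lshift N f) (lshift M g) = lshift (N + M) (f * g).
Proof. by apply: laurentP; apply: lmul_shift. Qed.

Lemma lshiftD N f g : ladd (lshift N f) (lshift N g) = lshift N (f + g).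
Proof.
by apply: laurentP => n /=; rewrite /lmono_fps; case: ifP; rewrite ?addr0.
Qed.

Lemma lshift_inj N : injective (lshift N).
Proof.
move=> f g fg; apply: fpsP => n.
have := congr1 (fun u => lcoef u (N + n%:Z)) fg.
by rewrite /= /lmono_fps addrC addKr.
Qed.

Fact lmulA : associative lmul.
Proof.
move=> u v w; have [N [f ->]] := lshift_ex u.
have [M [g ->]] := lshift_ex v; have [L [h ->]] := lshift_ex w.
by rewrite !lmulE mulrA addrA.
Qed.
Fact lmulC : commutative lmul.
Proof.
move=> u v; have [N [f ->]] := lshift_ex u.
by have [M [g ->]] := lshift_ex v; rewrite !lmulE mulrC addrC.
Qed.

Definition lconst (a : A) : laurent A := lshift 0 (fconst a).
Definition lX : laurent A := lshift 1 1.

Fact lmul1 : left_id (lconst 1) lmul.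
Proof.
move=> u; have [N [f ->]] := lshift_ex u.
by rewrite lmulE add0r mul1r.
Qed.
Fact lmulD : left_distributive lmul ladd.
Proof.
move=> u v w; have [L [h ->]] := lshift_ex w.
have [[N uN] [M vM]] := (lcoefP u, lcoefP v).
have [|f ->] := @lshift_bound u (Num.min N M).
  by move=> n; rewrite lt_min => /andP[/uN].
have [|g ->] := @lshift_bound v (Num.min N M).
  by move=> n; rewrite lt_min => /andP[_ /vM].
by rewrite lshiftD !lmulE lshiftD mulrDl.
Qed.
Fact l1_neq0 : lconst 1 != lzero.
Proof.
apply/eqP => /(congr1 (fun u => lcoef u 0)) /= /eqP.
by rewrite /lmono_fps subrr lexx /= oner_eq0.
Qed.

HB.instance Definition _ := GRing.Zmodule_isComNzRing.Build (laurent A)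
  lmulA lmulC lmul1 lmulD l1_neq0.

Lemma lcoefD u v n : (u + v) n = u n + v n. Proof. by []. Qed.

Definition lscale (a : A) u : laurent A := lconst a * u.

Lemma lscaleE a u n : lscale a u n = a * u n.
Proof.
have [N [f ->]] := lshift_ex u; rewrite /lscale.
rewrite [_ * _]lmulE add0r /= /lmono_fps; case: ifP; rewrite ?mulr0 // => _.
rewrite fcoefM big_ord_recl subn0 big1 ?addr0 // => i _.
by rewrite mul0r.
Qed.

Fact lscaleA a b u : lscale a (lscale b u) = lscale (a * b) u.
Proof. by apply: laurentP => n; rewrite !lscaleE mulrA. Qed.
Fact lscale1 : left_id 1 lscale.
Proof. by move=> u; apply: laurentP => n; rewrite lscaleE mul1r. Qed.
Fact lscaleDr : right_distributive lscale +%R.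
Proof. by move=> a u v; rewrite /lscale mulrDr. Qed.
Fact lscaleDl u : {morph lscale^~ u : a b / a + b}.
Proof.
by move=> a b; apply: laurentP => n; rewrite lcoefD !lscaleE mulrDl.
Qed.

HB.instance Definition _ := GRing.Zmodule_isLmodule.Build A (laurent A)
  lscaleA lscale1 lscaleDr lscaleDl.

Lemma lcoefN u n : (- u) n = - u n. Proof. by []. Qed.
Lemma lcoef0 n : (0 : laurent A) n = 0. Proof. by []. Qed.
Lemma lcoefM u v n : (u * v) n = \sum_(i \in [set: int]) u i * v (n - i).
Proof. by []. Qed.
Lemma lcoefZ a u n : (a *: u) n = a * u n. Proof. exact: lscaleE. Qed.

(* A[[X]] inside A((X)) *)
Definition lau_of_fps f : laurent A := lshift 0 f.

Definition lderiv u : laurent A := lau_of (fun n => u (n + 1) *~ (n + 1)).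

Lemma lderivE u n : lderiv u n = u (n + 1) *~ (n + 1).
Proof.
rewrite lau_ofE //; have [N uN] := lcoefP u; exists (N - 1) => m mN.
by rewrite uN ?mul0rz // -ltrBrDr.
Qed.

End LaurentRing.

Section LaurentField.
Variable F : fieldType.
Implicit Types u v : laurent F.

Lemma linv_ex u : u != 0 -> exists v, v * u = 1.
Proof.
move=> u0; have [N [f uE]] := lshift_ex u.
have fn0 : exists n, f n != 0.
  apply: contrapT => fn; case/eqP: u0; rewrite uE; apply: laurentP => n.
  rewrite /= /lmono_fps; case: ifP => // _.
  by apply/eqP; apply: contra_notT fn => fn; exists `|(n - N)%R|%N.
have [n fn nmin] := ex_minnP fn0.
have [g uE'] : exists g, u = lshift (N + n%:Z) g.
  apply: lshift_bound => m mN; rewrite uE /= /lmono_fps; case: ifP => // Nm.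
  by apply/eqP; apply: contraTT mN => /nmin; rewrite -leNgt; lia.
have gu : g \is a GRing.unit.
  have := congr1 (fun v => lcoef v (N + n%:Z)) (etrans (esym uE) uE').
  rewrite /= /lmono_fps subrr /= addrC addKr /= => fg.
  by rewrite unfold_in /= /funit -fg unitfE.
exists (lshift (- (N + n%:Z)) g^-1); rewrite uE' [_ * _]lmulE addNr mulVr //.
Qed.

Definition linv u : laurent F :=
  if pselect (exists v, v * u = 1) is left e then projT1 (cid e) else 0.

Fact lmulV u : u != 0 -> linv u * u = 1.
Proof.
move=> /linv_ex u0; rewrite /linv; case: pselect => // e.
exact: (projT2 (cid e)).
Qed.
Fact linv0 : linv 0 = 0.
Proof.
rewrite /linv; case: pselect => // e; exfalso.
by case: e => v /eqP; rewrite mulr0 eq_sym oner_eq0.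
Qed.

HB.instance Definition _ :=
  GRing.ComNzRing_isField.Build (laurent F) lmulV linv0.

End LaurentField.

Section RiemannSurface.
Variables (C : numFieldType) (X : topologicalType).

(* Only the restrictions of chart_map to chart_dom and of chart_inv to the    *)
(* image of chart_dom are meaningful.                                        *)
Record chart := Chart {
  chart_dom : set X;
  chart_map : X -> C;
  chart_inv : C -> X }.

Definition is_chart (c : chart) : Prop :=
  [/\ open (chart_dom c),
      open (chart_map c @` chart_dom c),
      forall x, chart_dom c x -> chart_inv c (chart_map c x) = x,
      {within chart_dom c, continuous (chart_map c)} &
      {within chart_map c @` chart_dom c, continuous (chart_inv c)}].

Definition transition (c d : chart) : C -> C := chart_map d \o chart_inv c.

Definition holo_compatible (c d : chart) : Prop :=
  forall x, chart_dom c x -> chart_dom d x ->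
    derivable (transition c d) (chart_map c x) 1 /\
    derivable (transition d c) (chart_map d x) 1.

Record riemann_surface := RiemannSurface {
  atlas : set chart;
  atlas_chart : forall c, atlas c -> is_chart c;
  atlas_cover : forall x, exists2 c, atlas c & chart_dom c x;
  atlas_compatible : forall c d, atlas c -> atlas d -> holo_compatible c d }.

Variable M : riemann_surface.

Definition coordinate_at (x : X) (c : chart) : Prop :=
  [/\ is_chart c, forall d, atlas M d -> holo_compatible c d & chart_dom c x].

(* f is given near x, except perhaps at x, by the convergent Laurent series k *)
(* in the variable c - c(x)                                                  *)
Definition expansion (c : chart) (x : X) (f : X -> C) (k : laurent C) : Prop :=
  exists N : nat, (forall n, n < - N%:Z -> k n = 0) /\
    \forall t \near (0 : C)^',
      series (fun j : nat => k (j%:Z - N%:Z) * t ^ (j%:Z - N%:Z)) @ \oo -->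
      f (chart_inv c (chart_map c x + t)).

(* The values of a meromorphic function at its poles are irrelevant, and so   *)
(* are its values at isolated points.                                        *)
Definition meromorphic (f : X -> C) : Prop :=
  forall x c, coordinate_at x c -> exists k, expansion c x f k.

Definition regular_at (f : X -> C) (x : X) : Prop :=
  exists c k, [/\ coordinate_at x c, expansion c x f k &
                  forall n, n < 0 -> k n = 0].

(* A meromorphic differential equals (mdiff c) dc on the domain of c.         *)
Record mero_differential := MeroDifferential {
  mdiff : chart -> X -> C;
  mdiff_meromorphic : forall x c, coordinate_at x c ->
    exists k, expansion c x (mdiff c) k;
  mdiff_change : forall x c d, coordinate_at x c -> coordinate_at x d ->
    \forall t \near (0 : C)^',
      let y := chart_inv c (chart_map c x + t) in
      mdiff c y = mdiff d y * derive1 (transition c d) (chart_map c y) }.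

Variable omega : mero_differential.

Definition nonzero_differential : Prop :=
  exists x c k,
    [/\ coordinate_at x c, expansion c x (mdiff omega c) k & k <> 0].

Definition zero_of_differential (x : X) : Prop :=
  exists c k, [/\ coordinate_at x c, expansion c x (mdiff omega c) k &
                  forall n, n <= 0 -> k n = 0].

Definition pole_of_differential (x : X) : Prop :=
  exists c k, [/\ coordinate_at x c, expansion c x (mdiff omega c) k &
                  exists2 n, n < 0 & k n <> 0].

Variable S : {fset X}.

Definition local_coordinates (zc : S -> chart) : Prop :=
  forall s : S, coordinate_at (val s) (zc s) /\ chart_map (zc s) (val s) = 0.

(* h s dz_s is the Laurent expansion of omega at s *)
Definition differential_expansion (zc : S -> chart) (h : S -> laurent C) :=
  forall s : S, expansion (zc s) (val s) (mdiff omega (zc s)) (h s).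

(* The image in K = \bigoplus_s C((z_s)) of the ring of meromorphic functions *)
(* on X regular outside S.                                                   *)
Definition functions_regular_outside (zc : S -> chart) : set (S -> laurent C) :=
  [set k | exists f : X -> C,
    [/\ meromorphic f, forall x, x \notin S -> regular_at f x &
        forall s : S, expansion (zc s) (val s) f (k s)]].

End RiemannSurface.

Definition adic_cvg (A : nmodType) (u : nat -> laurent A) (x : laurent A) :=
  forall n : int, exists k0 : nat, forall k, (k0 <= k)%N ->
    forall j, j < n -> u k j = x j.

Section LocalFields.
Variables (C : numFieldType) (I : finType).
Local Notation K := (I -> laurent C).

Variable h : K.

Definition pairing (f g : K) : C := \sum_s (f s * g s * h s) (- 1).

Definition deriv_at (hs f : laurent C) : laurent C := lderiv f / hs.

Definition deriv_K (f : K) : K := fun s => deriv_at (h s) (f s).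

Definition integral_K : set K := [set f | forall s n, n < 0 -> f s n = 0].

Definition subspace (L : set K) : Prop :=
  L 0 /\ forall (a : C) x y, L x -> L y -> L (a *: x + y).

Definition isotropic (L : set K) : Prop :=
  forall x y, L x -> L y -> pairing x y = 0.

Definition maximal_isotropic (L : set K) : Prop :=
  [/\ subspace L, isotropic L &
      forall L', subspace L' -> isotropic L' -> L `<=` L' -> L' = L].

Definition complement (L M : set K) : Prop :=
  L `&` M = [set 0] /\ forall x, exists y z, [/\ L y, M z & x = y + z].

(* L / M is finite-dimensional *)
Definition finite_codim (M L : set K) : Prop :=
  exists (n : nat) (v : 'I_n -> K), forall x, L x ->
    exists c : 'I_n -> C, M (x - \sum_i c i *: v i).

Definition commensurable (L M : set K) : Prop :=
  finite_codim (L `&` M) L /\ finite_codim (L `&` M) M.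

Definition K_cvg (u : nat -> K) (x : K) : Prop :=
  forall s, adic_cvg (fun k => u k s) (x s).

Definition linear_basis (L : set K) (e : nat -> K) : Prop :=
  [/\ forall i, L (e i),
      forall x, L x -> exists n (c : nat -> C), x = \sum_(i < n) c i *: e i &
      forall n (c : nat -> C), \sum_(i < n) c i *: e i = 0 ->
        forall i, (i < n)%N -> c i = 0].

Definition topological_basis (L : set K) (e : nat -> K) : Prop :=
  [/\ forall i, L (e i),
      forall x, L x ->
        exists c : nat -> C, K_cvg (fun k => \sum_(i < k) c i *: e i) x &
      forall c : nat -> C, K_cvg (fun k => \sum_(i < k) c i *: e i) 0 ->
        forall i, c i = 0].

(* T f = sinh(hbar D) / (hbar D) f = \sum_k hbar^(2k) / (2k + 1)! D^(2k) f     *)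
Definition sinh_op (f : K) (s : I) : fps (laurent C) :=
  Fps (fun n => if odd n then 0
                else (n.+1`!%:R : C)^-1 *: iter n deriv_K f s).

(* exp(a hbar D) z_s *)
Definition exp_coordinate (a : C) (s : I) : fps (laurent C) :=
  Fps (fun n => (a ^+ n / n`!%:R) *: iter n (deriv_at (h s)) (lX C)).

End LocalFields.

(* laurent (laurent C) is C((z))((w)): the coefficient of z^m w^n of u is      *)
(* u n m. It contains C((z, w)), as the set of u whose pole order in z is     *)
(* bounded independently of the power of w, and K (x) K embeds in the product *)
(* over pairs (s, t) of the C((z_s))((w_t)).                                  *)
Section TwoVariables.
Variable C : numFieldType.
Local Notation L2 := (laurent (laurent C)).

Definition tensor (f g : laurent C) : L2 := lmap (fun a : C => a *: f) g.

(* a^(21)(z, w) = a(w, z), for a in C((z, w)) *)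
Definition lswap (u : L2) : L2 := lau_of (fun n => lau_of (fun m => u m n)).

Definition in_Czw (u : L2) : Prop :=
  exists N : int, forall n m, m < N -> u n m = 0.

Definition diff_zw : L2 := lconst (lX C) - lX (laurent C).

(* F(zeta(w), w) = v for F in C((z, w))[[hbar]], as the limit of the values of *)
(* the truncations of F                                                      *)
Definition truncated_value (F : fps L2) (zeta : fps (laurent C)) (N : nat) :
    fps (laurent C) :=
  \sum_(k < N) \sum_(i < N.*2) \sum_(j < N.*2)
    let n := i%:Z - N%:Z in let m := j%:Z - N%:Z in
    fX _ ^+ k * fconst (F k n m *: lX C ^ n) * zeta ^ m.

Definition value_at (F : fps L2) (zeta v : fps (laurent C)) : Prop :=
  forall j, adic_cvg (fun N => truncated_value F zeta N j) (v j).

(* The quotient of the values of F and G in the field C((w))((hbar)) is x.    *)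
Definition quotient_at (F G : fps L2) (zeta : fps (laurent C))
    (x : laurent (laurent C)) : Prop :=
  exists a b, [/\ value_at F zeta a, value_at G zeta b, b <> 0 &
                  x = lau_of_fps a / lau_of_fps b].

Variable I : finType.

(* The element sum_i u_i (x) v_i, for v_i -> 0 *)
Definition is_tensor_sum (u v : nat -> I -> laurent C) (G : I -> I -> L2) :=
  forall s t, adic_cvg (fun k => \sum_(i < k) tensor (u i s) (v i t)) (G s t).

Definition in_tensor_square (B : set (I -> laurent C)) (a : I -> I -> L2) :=
  exists n (u v : 'I_n -> I -> laurent C),
    [/\ forall i, B (u i), forall i, B (v i) &
        forall s t, a s t = \sum_i tensor (u i s) (v i t)].

End TwoVariables.

Section Universal.
Variable C : numFieldType.

(* C[gamma_0, gamma_1, ...] *)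
Definition gpoly := malg (cmonom nat) C.

Definition gvar (i : nat) : gpoly := mkmalgU (ucm i) 1.

(* D = \sum_i gamma_(i+1) d/dgamma_i *)
Definition gderiv (p : gpoly) : gpoly :=
  \sum_(m <- msupp p) \sum_(i <- finsupp m)
    mkmalgU (mulcm (ucm i.+1) (divcm m (ucm i))) (mcoeff m p *+ m i).

Definition is_psi (psi : fps gpoly) : Prop :=
  psi 0 = 0 /\
  fderiv psi = fmap_fps gderiv psi - 1 - fconst (gvar 0) * psi ^+ 2.

Definition is_varphi (psi varphi : fps gpoly) : Prop :=
  varphi 0 = 0 /\
  fderiv varphi = fmap_fps gderiv varphi - fconst (gvar 0) * psi.

Local Notation L2 := (laurent (laurent C)).

(* gamma_i is replaced by (D^i (x) 1) g, with D = h^-1 d/dz *)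
Definition geval (hs : laurent C) (g : L2) (p : gpoly) : L2 :=
  mmap (fun c : C => lconst (lconst c))
       (fun m : cmonom nat =>
          \prod_(i <- finsupp m) iter i (lmap (deriv_at hs)) g ^+ m i) p.

Definition psi_plus hs g (psi : fps gpoly) : fps L2 :=
  fmap_fps (geval hs g) psi.

Definition psi_minus hs g (psi : fps gpoly) : fps L2 :=
  fcompN (psi_plus hs g psi).

Definition phi_series hs g (varphi : fps gpoly) : fps L2 :=
  let v := fmap_fps (geval hs g) varphi in
  fconst 2^-1 * fdivX (v - fcompN v).

(* Numerator and denominator of q(z, w), multiplied by z - w. *)
Definition q_num hs g psi varphi (tau : fps L2) (G : L2) : fps L2 :=
  fexp (2 * fX _ * (tau - phi_series hs g varphi)) *
  fconst (diff_zw C) * (1 + psi_plus hs g psi * fconst G).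

Definition q_den hs g psi (G : L2) : fps L2 :=
  fconst (diff_zw C) * (1 + psi_minus hs g psi * fconst G).

End Universal.

(* Main.v *)
Require Import Defs.
From HB Require Import structures.
From mathcomp Require Import all_boot all_order all_algebra finmap.
From mathcomp Require Import all_classical all_reals topology normedtype.
From mathcomp Require Import sequences derive complex.
From mathcomp.multinomials Require Import -(notations) monalg.
From mathcomp Require Import zify ring.

(** Why the theorem holds.  Put D = z - w, and let psi stand for the image of the
    universal series under gamma_i |-> (d_z^i) gamma, with d_z = h(z)^-1 d/dz.  Since
    d_z G = gamma + G^2, the defining equation of psi gives
      (d/dhbar - d_z) (1 + psi G) = - (G + gamma psi) (1 + psi G).
    Multiplying by D replaces the factor G by G + 1 / (h(z) (z - w)).  The point is
    that this sum has no pole left on the diagonal: it lies in C((z, w)).  Hence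
    along z = exp(- hbar d) w the restriction of A = D (1 + psi G) satisfies a
    homogeneous linear differential equation in hbar with coefficients in C((w)).
    Its initial value is that of z - w at z = w, namely 0, so it vanishes
    identically.  Replacing hbar by - hbar gives the same statement for the
    denominator along z = exp(hbar d) w.  The other member of each quotient does not
    vanish, because its coefficient of hbar is - 2 / h(w) or 2 / h(w).

    The singular part of G on the diagonal comes from duality
    ([in_Czw_kernel]): the coefficient of w^n in G is minus the component along R of
    the element z^(- 1 - n) / h of K = R + Lambda, so it differs from
    - z^(- 1 - n) / h by an element of Lambda, and the pole orders of the elements of
    Lambda are bounded because Lambda is commensurable with the integral elements
    ([poles_bounded]).  This needs h <> 0 at the given point, which follows from the
    maximality of Lambda ([weight_neq0]).

    The value at z = exp(a hbar d) w is handled by Taylor's formula: it is the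
    restriction to z = w of exp (hbar a d_z) applied to the series
    ([taylor_value]).  In this form the value is a ring morphism, and its derivative
    in hbar is the value of (d/dhbar + a d_z) F; that it is also the limit of the values
    of truncations is [taylor_valueP]. *)

Import Order.TTheory GRing.Theory Num.Theory.
Import numFieldNormedType.Exports.
Local Open Scope classical_set_scope.
Local Open Scope ring_scope.

Set Implicit Arguments.
Unset Strict Implicit.
Unset Printing Implicit Defensive.

Local Notation lshift := Defs.lshift.

(** * Derivations and formal power series *)

Section Derivation.
Variable A : comNzRingType.

Definition is_derivation (d : A -> A) : Prop :=
  {morph d : x y / x + y} /\ forall x y, d (x * y) = d x * y + x * d y.

Variable d : A -> A.
Hypothesis d_der : is_derivation d.

Lemma derivation0 : d 0 = 0.
Proof. by apply: (addrI (d 0)); rewrite -d_der.1 !addr0. Qed.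

Lemma derivationN x : d (- x) = - d x.
Proof. by apply/eqP; rewrite -addr_eq0 -d_der.1 addNr derivation0. Qed.

Lemma derivationB x y : d (x - y) = d x - d y.
Proof. by rewrite d_der.1 derivationN. Qed.

Lemma derivation1 : d 1 = 0.
Proof.
by apply: (addrI (d 1)); rewrite addr0 -{3}[1]mulr1 d_der.2 mul1r mulr1.
Qed.

Lemma derivation_sum (I : Type) (r : seq I) (P : pred I) (F : I -> A) :
  d (\sum_(i <- r | P i) F i) = \sum_(i <- r | P i) d (F i).
Proof. exact: (big_morph d d_der.1 derivation0). Qed.

Lemma derivationX x n : d (x ^+ n) = (x ^+ n.-1 * d x) *+ n.
Proof.
elim: n => [|n IHn]; first by rewrite expr0 derivation1.
rewrite exprS d_der.2 IHn /= mulrnAr mulrS mulrC; congr (_ + _).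
by case: n {IHn} => [|n] //=; rewrite exprS mulrA.
Qed.

End Derivation.

Section FpsTheory.
Variable A : comNzRingType.
Implicit Types u v : fps A.

Lemma fconst_is_additive : additive (@fconst A).
Proof. by move=> a b; apply: fpsP => -[|n]; rewrite fcoefB //= subrr. Qed.
HB.instance Definition _ := GRing.isAdditive.Build A (fps A) (@fconst A)
  fconst_is_additive.

Lemma fconst_is_multiplicative : multiplicative (@fconst A).
Proof.
split=> // a b; apply: fpsP => -[|n].
  by rewrite fcoefM big_ord_recl big_ord0 addr0.
by rewrite fcoefM big1 // => -[[|i] /= _] _; rewrite ?mulr0 ?mul0r.
Qed.
HB.instance Definition _ := GRing.isMultiplicative.Build A (fps A) (@fconst A)
  fconst_is_multiplicative.

Lemma fconstME a u n : (fconst a * u) n = a * u n.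
Proof.
rewrite fcoefM big_ord_recl big1 ?addr0 ?subn0 // => i _.
by rewrite /= mul0r.
Qed.

Lemma fXME u n : (fX A * u) n = if n is m.+1 then u m else 0.
Proof.
case: n => [|n]; first by rewrite fcoefM big_ord_recl big_ord0 addr0 mul0r.
rewrite fcoefM 2!big_ord_recl /= mul0r add0r mul1r subn1 big1 ?addr0 // => i _.
by rewrite /= mul0r.
Qed.

Lemma fXnME u k n : (fX A ^+ k * u) n = if (k <= n)%N then u (n - k)%N else 0.
Proof.
elim: k n => [|k IHk] n; first by rewrite expr0 mul1r subn0.
by rewrite exprS -mulrA fXME; case: n => [|n] //; rewrite IHk.
Qed.

Lemma fderiv_derivation : is_derivation (@fderiv A).
Proof.
split=> [u v|u v]; apply: fpsP => n; first by rewrite /= mulrnDl.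
pose t : fps A -> {poly A} := ftrunc n.+1.
transitivity ((t u * t v)^`()`_n).
  by rewrite coef_deriv -ftruncM.
have dt w i : (i <= n)%N -> (t w)^`()`_i = fderiv w i.
  by move=> ni; rewrite coef_deriv ftruncE.
rewrite derivM coefD !coefM !fcoefD !fcoefM.
congr (_ + _); apply: eq_bigr => i _; have ni := ltn_ord i.
  by rewrite dt // ftruncE // leqW // leq_subr.
by rewrite dt ?leq_subr // ftruncE // leqW // -ltnS.
Qed.

Lemma fderiv_const (a : A) : fderiv (fconst a) = 0.
Proof. by apply: fpsP => n; rewrite /= mul0rn. Qed.

Lemma fmap_derivation d : is_derivation d ->
  is_derivation (fmap_fps d : fps A -> fps A).
Proof.
move=> dd; split=> u v; apply: fpsP => n; first by rewrite /= dd.1.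
rewrite fcoefD !fcoefM /= (derivation_sum dd) -big_split.
by apply: eq_bigr => i _; rewrite dd.2.
Qed.

Lemma fmap_fconst (B : comNzRingType) (f : A -> B) a : f 0 = 0 ->
  fmap_fps f (fconst a) = fconst (f a).
Proof. by move=> f0; apply: fpsP => -[|n]. Qed.

(** Restriction of f(z, w) in A[[z, w]] to z = w. *)
Definition diag_fps (F : fps (fps A)) : fps A :=
  Fps (fun n => \sum_(i < n.+1) F i (n - i)%N).

Lemma diag_fpsE F n : diag_fps F n = \sum_(i < n.+1) F i (n - i)%N.
Proof. by []. Qed.

Lemma diag_fpsD F G : diag_fps (F + G) = diag_fps F + diag_fps G.
Proof.
by apply: fpsP => n; rewrite /= -big_split; apply: eq_bigr.
Qed.

(** The coefficients up to order n depend on truncations only, and for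
    polynomials in two variables the restriction is evaluation at the other
    variable, which is a ring morphism. *)
Lemma diag_fpsM F G : diag_fps (F * G) = diag_fps F * diag_fps G.
Proof.
apply: fpsP => n.
pose t (H : fps (fps A)) : {poly {poly A}} := \poly_(i < n.+1) ftrunc n (H i).
have tE H i : (i <= n)%N -> (t H)`_i = ftrunc n (H i).
  by move=> ni; rewrite coef_poly ltnS ifT.
have evalE (P : {poly {poly A}}) k :
    P.['X]`_k = \sum_(i < k.+1) P`_i`_(k - i).
  pose N := maxn k.+1 (size P).
  rewrite (@horner_coef_wide _ N) ?leq_maxr // coef_sum.
  rewrite [RHS](big_ord_widen N (fun i => P`_i`_(k - i))) ?leq_maxl //.
  rewrite [RHS]big_mkcond; apply: eq_bigr => i _.
  by rewrite coefMXn ltnS; case: leqP.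
have diagE H k : (k <= n)%N -> diag_fps H k = (t H).['X]`_k.
  move=> kn; rewrite evalE diag_fpsE; apply: eq_bigr => i _.
  have ik : (i <= k)%N by rewrite -ltnS.
  by rewrite tE ?ftruncE // (leq_trans _ kn) // leq_subr.
transitivity ((t F * t G).['X]`_n).
  rewrite evalE diag_fpsE; apply: eq_bigr => i _; have ni := ltn_ord i.
  rewrite !coefM coef_sum fcoefM fcoef_sum; apply: eq_bigr => j _.
  have ji := ltn_ord j.
  by rewrite !tE -?ftruncM ?leq_subr //; lia.
rewrite hornerM coefM fcoefM; apply: eq_bigr => i _.
by rewrite !diagE ?leq_subr // -ltnS.
Qed.

Lemma diag_fps_const f : diag_fps (fconst f) = f.
Proof.
apply: fpsP => n; rewrite /= big_ord_recl subn0 big1 ?addr0 // => i _.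
Qed.

End FpsTheory.

(** * Laurent series *)

Section LaurentTheory.
Variable A : comNzRingType.
Implicit Types (u v : laurent A) (f g : fps A).

Lemma lcoef_sum (I : Type) (r : seq I) (P : pred I) (F : I -> laurent A) n :
  (\sum_(i <- r | P i) F i) n = \sum_(i <- r | P i) F i n.
Proof. exact: (big_morph (fun u : laurent A => u n)). Qed.

Lemma lshiftE N f n :
  lshift N f n = if 0 <= n - N then f `|n - N|%N else 0.
Proof. by []. Qed.

Lemma lshift_is_additive N : additive (@lshift A N).
Proof.
move=> f g; apply: laurentP => n.
rewrite lcoefD lcoefN !lshiftE fcoefB; case: ifP => //.
by rewrite subr0.
Qed.
HB.instance Definition _ N := GRing.isAdditive.Build (fps A) (laurent A)
  (@lshift A N) (lshift_is_additive N).

Lemma lshiftM N M f g : lshift N f * lshift M g = lshift (N + M) (f * g).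
Proof. exact: lmulE. Qed.

Lemma lcoefMn u k n : (u *+ k) n = u n *+ k.
Proof.
by elim: k => [|k IHk]; rewrite ?mulr0n // !mulrS lcoefD IHk.
Qed.

Lemma lshift_prefix N f : (forall n, n < N -> lshift N f n = 0).
Proof. by move=> n nN; rewrite lshiftE ifN // -ltNge subr_lt0. Qed.

Lemma lcoefM_lt u v a b n : (forall i, i < a -> u i = 0) ->
  (forall i, i < b -> v i = 0) -> n < a + b -> (u * v) n = 0.
Proof.
move=> /lshift_bound[f ->] /lshift_bound[g ->] nab.
by rewrite lshiftM lshift_prefix.
Qed.

Lemma lconst_is_additive : additive (@lconst A).
Proof. by move=> a b; rewrite /lconst !raddfB. Qed.
HB.instance Definition _ := GRing.isAdditive.Build A (laurent A) (@lconst A)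
  lconst_is_additive.

Lemma lconst_is_multiplicative : multiplicative (@lconst A).
Proof.
split=> // a b.
by rewrite /lconst lshiftM addr0 rmorphM.
Qed.
HB.instance Definition _ := GRing.isMultiplicative.Build A (laurent A)
  (@lconst A) lconst_is_multiplicative.

Lemma lconstE (a : A) n : lconst a n = if n == 0 then a else 0.
Proof. by rewrite lshiftE subr0; case: n => [[|n]|n]. Qed.

Lemma lconstME a u n : (lconst a * u) n = a * u n.
Proof. exact: lscaleE. Qed.

Lemma lXXn k : lX A ^+ k = lshift k%:Z 1.
Proof.
elim: k => [|k IHk]; first by rewrite expr0.
by rewrite exprS IHk lshiftM mulr1 -intS.
Qed.

Lemma lXnE k n : (lX A ^+ k) n = (n == k%:Z)%:R.
Proof.
rewrite lXXn lshiftE; case: eqP => [->|nk]; first by rewrite subrr.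
case: ifP => // nk0; rewrite fcoef1 ifN //; lia.
Qed.

Lemma lshift_fconst N (a : A) n :
  lshift N (fconst a) n = if n == N then a else 0.
Proof.
rewrite lshiftE; case: eqP => [->|nN]; first by rewrite subrr.
by case: ifP => // nN0 /=; rewrite ifN //; lia.
Qed.

(** On X^N f the derivation d/dX acts as N + X d/dX on f, up to a shift; this
    reduces Leibniz' rule to power series. *)
Lemma lderiv_lshift N f :
  lderiv (lshift N f) = lshift (N - 1) (fconst N%:~R * f + fX A * fderiv f).
Proof.
apply: laurentP => n; rewrite lderivE !lshiftE.
have -> : n + 1 - N = n - (N - 1) by lia.
case: ifP => [|_]; last by rewrite mul0rz.
case nE : (n - (N - 1)) => [k|//] _.
have -> : n + 1 = N + k%:Z by lia.
rewrite fcoefD fconstME fXME -mulrzl intrD mulrDl [_%:~R * _]mulrzl.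
by rewrite absz_nat -pmulrn; case: k {nE} => [|k]; rewrite ?mul0r // mulr_natl.
Qed.

Lemma lderiv_derivation : is_derivation (@lderiv A).
Proof.
split=> u v.
  by apply: laurentP => n; rewrite lcoefD !lderivE lcoefD mulrzDl.
have [[N [f ->]] [M [g ->]]] := (lshift_ex u, lshift_ex v).
rewrite !(lderiv_lshift, lshiftM).
have -> : N - 1 + M = N + M - 1 by lia.
rewrite addrA -raddfD /=; congr (lshift _ _).
rewrite (fderiv_derivation A).2 intrD raddfD /=; ring.
Qed.

Lemma lderiv_lt u a : (forall n, n < a -> u n = 0) ->
  forall n, n < a - 1 -> lderiv u n = 0.
Proof. by move=> ua n na; rewrite lderivE ua ?mul0rz //; lia. Qed.

Lemma lderivX : lderiv (lX A) = 1.
Proof.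
apply: laurentP => n; rewrite lderivE -[lX A]expr1 lXnE [RHS]lconstE.
have [->|n0] := eqVneq n 0; first by [].
have -> : (n + 1 == 1%N) = false by lia.
by rewrite mul0rz.
Qed.

Lemma lmap_lshift (d : A -> A) N f : d 0 = 0 ->
  lmap d (lshift N f) = lshift N (fmap_fps d f).
Proof.
move=> d0; apply: laurentP => n; rewrite lmapE // !lshiftE.
by case: ifP => // _; rewrite d0.
Qed.

Lemma lmap_derivation (d : A -> A) : is_derivation d ->
  is_derivation (lmap d : laurent A -> laurent A).
Proof.
move=> dd; have d0 := derivation0 dd; split=> u v.
  by apply: laurentP => n; rewrite lcoefD !lmapE // lcoefD dd.1.
have [[N [f ->]] [M [g ->]]] := (lshift_ex u, lshift_ex v).
rewrite lshiftM !lmap_lshift // !lshiftM -raddfD /=.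
by rewrite (fmap_derivation dd).2.
Qed.

Lemma lmap_lconst (d : A -> A) (a : A) : d 0 = 0 ->
  lmap d (lconst a) = lconst (d a).
Proof.
by move=> d0; apply: laurentP => n; rewrite lmapE // !lconstE; case: ifP.
Qed.

Lemma lmap_lX (d : A -> A) : is_derivation d -> lmap d (lX A) = 0.
Proof.
move=> dd; have d0 := derivation0 dd; apply: laurentP => n.
rewrite lmapE // -[lX A]expr1 lXnE; case: eqP => _ //.
by rewrite (derivation1 dd).
Qed.

End LaurentTheory.

(** * Restriction of C((z, w)) to the diagonal *)

Section Diagonal.
Variable A : numFieldType.
Local Notation L2 := (laurent (laurent A)).
Implicit Types (u v : L2) (f g : fps (fps A)).

(** w^a z^b f(z, w), for f in A[[z, w]]; these are the elements of C((z, w))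
    ([in_CzwP]). *)
Definition bishift (a b : int) f : L2 := lshift a (fmap_fps (lshift b) f).

Lemma bishiftE a b f n m : bishift a b f n m =
  if (0 <= n - a) && (0 <= m - b) then f `|n - a|%N `|m - b|%N else 0.
Proof.
by rewrite lshiftE; case: ifP => //= _; rewrite lshiftE.
Qed.

Lemma bishiftD a b f g : bishift a b f + bishift a b g = bishift a b (f + g).
Proof.
rewrite -raddfD /=; congr (lshift _ _).
by apply: fpsP => n /=; rewrite -raddfD.
Qed.

Lemma bishiftM a b c d f g :
  bishift a b f * bishift c d g = bishift (a + c) (b + d) (f * g).
Proof.
rewrite lshiftM; congr (lshift _ _); apply: fpsP => n.
rewrite fcoefM /= raddf_sum; apply: eq_bigr => i _ /=.
by rewrite lshiftM.
Qed.

Lemma bishift_ex u a b : (forall n, n < a -> u n = 0) ->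
  (forall n m, m < b -> u n m = 0) -> exists f, u = bishift a b f.
Proof.
move=> ua ub; exists (Fps (fun n => Fps (fun m => u (a + n%:Z) (b + m%:Z)))).
apply: laurentP => n; apply: laurentP => m; rewrite bishiftE.
have [na|na] := ltP n a; first by rewrite ifF ?ua //; lia.
have [mb|mb] := ltP m b; first by rewrite ifF ?ub //; lia.
rewrite ifT /=; last lia.
by congr (u _ _); lia.
Qed.

Lemma in_Czw_bishift a b f : in_Czw (bishift a b f).
Proof.
exists b => n m mb; rewrite bishiftE ifF //; lia.
Qed.

Lemma in_CzwP u : in_Czw u -> exists a b f, u = bishift a b f.
Proof.
move=> [b ub]; have [a ua] := lcoefP u.
by have [f ->] := bishift_ex ua ub; exists a, b, f.
Qed.

(** A common monomial denominator for two elements. *)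
Lemma in_CzwP2 u v : in_Czw u -> in_Czw v ->
  exists a b f g, u = bishift a b f /\ v = bishift a b g.
Proof.
move=> [b ub] [d vd]; have [[a ua] [c vc]] := (lcoefP u, lcoefP v).
have [|n m|f uE] := @bishift_ex u (Num.min a c) (Num.min b d).
- by move=> n; rewrite lt_min => /andP[/ua].
- by rewrite lt_min => /andP[/ub].
have [|n m|g vE] := @bishift_ex v (Num.min a c) (Num.min b d).
- by move=> n; rewrite lt_min => /andP[_ /vc].
- by rewrite lt_min => /andP[_ /vd].
by exists (Num.min a c), (Num.min b d), f, g.
Qed.

Lemma in_Czw0 : in_Czw (0 : L2).
Proof. by exists 0. Qed.

Lemma in_CzwD u v : in_Czw u -> in_Czw v -> in_Czw (u + v).
Proof.
move=> /in_CzwP2 h /h[a [b [f [g [-> ->]]]]].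
by rewrite bishiftD; apply: in_Czw_bishift.
Qed.

Lemma in_CzwN u : in_Czw u -> in_Czw (- u).
Proof.
move=> [b ub]; exists b => n m /(ub n) unm.
by have -> : (- u) n m = - u n m by []; rewrite unm oppr0.
Qed.

Lemma in_CzwM u v : in_Czw u -> in_Czw v -> in_Czw (u * v).
Proof.
move=> /in_CzwP[a [b [f ->]]] /in_CzwP[c [d [g ->]]].
by rewrite bishiftM; apply: in_Czw_bishift.
Qed.

Lemma lconst_bishift b (f : fps A) :
  lconst (lshift b f) = bishift 0 b (fconst f).
Proof.
apply: laurentP => n; rewrite lconstE lshiftE subr0.
by case: n => [[|n]|n] //=; rewrite raddf0.
Qed.

Lemma in_Czw_lconst (f : laurent A) : in_Czw (lconst f).
Proof.
by have [b [g ->]] := lshift_ex f; rewrite lconst_bishift; apply: in_Czw_bishift.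
Qed.

Lemma lX_bishift : lX (laurent A) = bishift 1 0 1.
Proof.
congr (lshift _ _); apply: fpsP => -[|n] //=.
by rewrite raddf0.
Qed.

Lemma in_Czw_lX : in_Czw (lX (laurent A)).
Proof. by rewrite lX_bishift; apply: in_Czw_bishift. Qed.

(** Restriction to the diagonal z = w. The sum is finite when u is in C((z,
    w)), but not for a general element of C((z))((w)). *)
Definition ldiag u : laurent A :=
  lau_of (fun p => \sum_(n \in [set: int]) u n (p - n)).

Lemma ldiag_bishift a b f : ldiag (bishift a b f) = lshift (a + b) (diag_fps f).
Proof.
have E p : \sum_(n \in [set: int]) bishift a b f n (p - n) =
    lshift (a + b) (diag_fps f) p.
  rewrite lshiftE; case: ifPn => [|pab]; last first.
    rewrite fsbig1 // => i _ /=; rewrite bishiftE ifF //; lia.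
  case pE : (p - (a + b)) => [k|//] _.
  pose r := [seq a + i%:Z | i <- index_iota 0 k.+1].
  rewrite (@fsbigE _ _ _ _ _ r) //; last first.
  - move=> i _ /= ir; rewrite bishiftE; case: ifPn => // ib.
    case/negP: ir; apply/mapP; exists `|(i - a)%R|%N; last lia.
    by rewrite mem_index_iota; lia.
  - by rewrite map_inj_uniq ?iota_uniq // => i j /addrI [].
  rewrite big_mkcond big_map big_mkord diag_fpsE absz_nat.
  apply: eq_bigr => i _; rewrite in_setT bishiftE.
  have ik := ltn_ord i; rewrite ifT; last lia.
  by congr (f _ _); lia.
apply: laurentP => p; rewrite lau_ofE ?E //.
by exists (a + b) => q qab; rewrite E lshift_prefix.
Qed.

Lemma ldiagD u v : in_Czw u -> in_Czw v -> ldiag (u + v) = ldiag u + ldiag v.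
Proof.
move=> /in_CzwP2 h /h[a [b [f [g [-> ->]]]]].
by rewrite bishiftD !ldiag_bishift diag_fpsD raddfD.
Qed.

Lemma ldiagM u v : in_Czw u -> in_Czw v -> ldiag (u * v) = ldiag u * ldiag v.
Proof.
move=> /in_CzwP[a [b [f ->]]] /in_CzwP[c [d [g ->]]].
rewrite bishiftM !ldiag_bishift diag_fpsM lshiftM; congr (lshift _ _); lia.
Qed.

Lemma ldiag0 : ldiag 0 = 0.
Proof.
by apply: (addrI (ldiag 0)); rewrite -ldiagD ?addr0 //; apply: in_Czw0.
Qed.

Lemma ldiagN u : in_Czw u -> ldiag (- u) = - ldiag u.
Proof.
move=> uC; apply/eqP; rewrite -addr_eq0 -ldiagD ?addNr ?ldiag0 //.
exact: in_CzwN.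
Qed.

Lemma ldiagB u v : in_Czw u -> in_Czw v -> ldiag (u - v) = ldiag u - ldiag v.
Proof. by move=> uC vC; rewrite ldiagD ?ldiagN //; apply: in_CzwN. Qed.

Lemma ldiag_lconst (f : laurent A) : ldiag (lconst f) = f.
Proof.
have [b [g ->]] := lshift_ex f.
by rewrite lconst_bishift ldiag_bishift add0r diag_fps_const.
Qed.

Lemma ldiag_lX : ldiag (lX (laurent A)) = lX A.
Proof. by rewrite lX_bishift ldiag_bishift addr0 diag_fps_const. Qed.

(** The total degree in z and w of every term is at least p. The filtration by
    total degree is what the diagonal restriction preserves, and convergence
    of the truncated values is measured by it. *)
Definition order_ge (p : int) u : Prop := forall n m, n + m < p -> u n m = 0.

Lemma ldiag_lt p u : in_Czw u -> order_ge p u -> forall n, n < p -> ldiag u n = 0.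
Proof.
move=> /in_CzwP[a [b [f ->]]] up n np.
rewrite lau_ofE; first by rewrite fsbig1 // => i _ /=; apply: up; lia.
by exists p => q qp; rewrite fsbig1 // => i _ /=; apply: up; lia.
Qed.

End Diagonal.

(** * The ring C((z, w))[[hbar]] *)

Section CzwClosure.
Variable C : numFieldType.
Local Notation L2 := (laurent (laurent C)).
Implicit Types (u v : L2) (F G : fps L2).

Lemma in_Czw1 : in_Czw (1 : L2).
Proof. exact: in_Czw_lconst. Qed.

Lemma in_Czw_sum (I : Type) (r : seq I) (P : pred I) (u : I -> L2) :
  (forall i, in_Czw (u i)) -> in_Czw (\sum_(i <- r | P i) u i).
Proof.
by move=> uC; apply: big_ind => //; [exact: in_Czw0|exact: in_CzwD].
Qed.

Lemma in_CzwMn u k : in_Czw u -> in_Czw (u *+ k).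
Proof.
move=> uC; elim: k => [|k IHk]; first exact: in_Czw0.
by rewrite mulrS; apply: in_CzwD.
Qed.

Lemma in_CzwX u k : in_Czw u -> in_Czw (u ^+ k).
Proof.
move=> uC; elim: k => [|k IHk]; first exact: in_Czw1.
by rewrite exprS; apply: in_CzwM.
Qed.

Lemma in_Czw_natV k : in_Czw (k%:R^-1 : L2).
Proof.
have -> : k%:R^-1 = lconst (k%:R^-1) :> L2 by rewrite fmorphV rmorph_nat.
exact: in_Czw_lconst.
Qed.

Lemma in_Czw_tensor (f g : laurent C) : in_Czw (tensor f g).
Proof.
have [N fN] := lcoefP f; exists N => n m mN.
have -> : tensor f g n = g n *: f by rewrite lmapE // scale0r.
by rewrite lcoefZ fN // mulr0.
Qed.

Lemma in_Czw_diff : in_Czw (diff_zw C).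
Proof.
apply: in_CzwD; first exact: in_Czw_lconst.
by apply: in_CzwN; apply: in_Czw_lX.
Qed.

Lemma ldiag_diff : ldiag (diff_zw C) = 0.
Proof.
rewrite ldiagB; [|exact: in_Czw_lconst|exact: in_Czw_lX].
by rewrite ldiag_lconst ldiag_lX subrr.
Qed.

Lemma in_Czw_tensor_square (I : finType) (B : set (I -> laurent C)) a s t :
  in_tensor_square B a -> in_Czw (a s t).
Proof.
move=> [n [u [v [_ _ ->]]]]; apply: in_Czw_sum => i; exact: in_Czw_tensor.
Qed.

Definition fps_Czw F := forall n, in_Czw (F n).

Lemma fps_CzwD F G : fps_Czw F -> fps_Czw G -> fps_Czw (F + G).
Proof. by move=> FC GC n; apply: in_CzwD. Qed.

Lemma fps_CzwN F : fps_Czw F -> fps_Czw (- F).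
Proof. by move=> FC n; apply: in_CzwN. Qed.

Lemma fps_CzwM F G : fps_Czw F -> fps_Czw G -> fps_Czw (F * G).
Proof.
by move=> FC GC n; rewrite fcoefM; apply: in_Czw_sum => i; apply: in_CzwM.
Qed.

Lemma fps_Czw_const u : in_Czw u -> fps_Czw (fconst u).
Proof. by move=> uC [|n] //; apply: in_Czw0. Qed.

Lemma fps_Czw1 : fps_Czw 1.
Proof. exact/fps_Czw_const/in_Czw1. Qed.

Lemma fps_CzwX F k : fps_Czw F -> fps_Czw (F ^+ k).
Proof.
move=> FC; elim: k => [|k IHk]; first exact: fps_Czw1.
by rewrite exprS; apply: fps_CzwM.
Qed.

Lemma fps_Czw_X : fps_Czw (fX L2).
Proof. by move=> [|[|n]]; [exact: in_Czw0|exact: in_Czw1|exact: in_Czw0]. Qed.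

Lemma fps_Czw_sum (I : Type) (r : seq I) (P : pred I) (F : I -> fps L2) :
  (forall i, fps_Czw (F i)) -> fps_Czw (\sum_(i <- r | P i) F i).
Proof. by move=> FC n; rewrite fcoef_sum; apply: in_Czw_sum => i; apply: FC. Qed.

Lemma fps_Czw_exp F : fps_Czw F -> fps_Czw (fexp F).
Proof.
move=> FC n; apply: in_Czw_sum => k; apply: in_CzwM; last exact: in_Czw_natV.
exact: fps_CzwX.
Qed.

Lemma fps_Czw_compN F : fps_Czw F -> fps_Czw (fcompN F).
Proof.
move=> FC n; apply: in_CzwM => //; apply: in_CzwX; apply: in_CzwN.
exact: in_Czw1.
Qed.

End CzwClosure.

(** * Values along the flow of a derivation *)

Section Taylor.
Variable C : numFieldType.
Local Notation L1 := (laurent C).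
Local Notation L2 := (laurent (laurent C)).
Implicit Types (u v : L2) (F G : fps L2).

Lemma lXz (m : int) : lX C ^ m = lshift m 1.
Proof.
case: m => k; first by rewrite -exprnP lXXn.
rewrite NegzE -exprnN; apply/mulr1_eq.
by rewrite lXXn lshiftM mulr1 subrr.
Qed.

Lemma laurent_mulrnI n : injective (fun f : L1 => f *+ n.+1).
Proof.
move=> f g /= uv; apply: laurentP => k.
by have /(congr1 (fun w => lcoef w k)) := uv; rewrite !lcoefMn => /pmulrnI; apply.
Qed.

Lemma fps_deriv_inj (u v : fps L1) : u 0%N = v 0%N -> fderiv u = fderiv v -> u = v.
Proof.
move=> uv0 duv; apply: fpsP => -[|n] //.
by apply: (@laurent_mulrnI n); have /(congr1 (fun w => fcoef w n)) := duv.
Qed.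

(** In the application d0 is a multiple of h^-1 d/dz; it lowers the order of
    vanishing by a bounded amount. *)
Variable d0 : L1 -> L1.
Hypothesis d0_der : is_derivation d0.
Hypothesis d0_const : forall c : C, d0 (lconst c) = 0.
Variable c : nat.
Hypothesis d0_lt : forall (f : L1) p, (forall n, n < p -> f n = 0) ->
  forall n, n < p - c%:Z -> d0 f n = 0.

Local Notation dz := (lmap d0 : L2 -> L2).

Lemma dz_der : is_derivation dz.
Proof. exact: lmap_derivation. Qed.

Lemma dzE (u : L2) n : dz u n = d0 (u n).
Proof. by rewrite lmapE // (derivation0 d0_der). Qed.

Lemma in_Czw_dz u : in_Czw u -> in_Czw (dz u).
Proof.
by move=> [b ub]; exists (b - c%:Z) => n m mb; rewrite dzE (d0_lt _ mb) // => k /ub.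
Qed.

(** d/dhbar + d_z, where d_z is d0 acting on the variable z. *)
Definition total_deriv F : fps L2 := fderiv F + fmap_fps dz F.

Lemma total_deriv_der : is_derivation total_deriv.
Proof.
have [fD fM] := fderiv_derivation L2.
have [gD gM] := fmap_derivation dz_der.
split=> F G; first by rewrite /total_deriv fD gD addrACA.
by rewrite /total_deriv fM gM; ring.
Qed.

Lemma fps_Czw_deriv F : fps_Czw F -> fps_Czw (total_deriv F).
Proof.
move=> FC n; apply: in_CzwD; first exact: in_CzwMn.
exact: in_Czw_dz.
Qed.

Lemma fps_Czw_iter F n : fps_Czw F -> fps_Czw (iter n total_deriv F).
Proof. by move=> FC; elim: n => //= n; apply: fps_Czw_deriv. Qed.

(** The value of F(hbar, z, w) at z = exp(hbar d0) w. As a function of hbar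
    its successive derivatives at hbar = 0 are the restrictions to hbar = 0, z
    = w of the iterates of d/dhbar + d_z on F: this is the Taylor formula
    below. *)
Definition taylor_value F : fps L1 :=
  Fps (fun n => (n`!%:R^-1 : C) *: ldiag (iter n total_deriv F 0%N)).

Local Notation V := taylor_value.

Lemma taylor_value_coef0 F : V F 0%N = ldiag (F 0%N).
Proof. by rewrite /= fact0 invr1 scale1r. Qed.

(** The chain rule, from which the rest follows by comparing derivatives. *)
Lemma fderiv_taylor F : fderiv (V F) = V (total_deriv F).
Proof.
apply: fpsP => n; apply: laurentP => k.
rewrite [LHS]lcoefMn !lcoefZ -iterSr factS natrM invfM -mulrnAl -mulrnAl.
by rewrite -[_^-1 *+ _]mulr_natr mulVf ?pnatr_eq0 // mul1r.
Qed.


Lemma taylor_valueD F G : fps_Czw F -> fps_Czw G -> V (F + G) = V F + V G.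
Proof.
move=> FC GC; apply: fpsP => n; rewrite fcoefD /= -scalerDr; congr (_ *: _).
rewrite -ldiagD; try exact: fps_Czw_iter.
congr ldiag; elim: n F G FC GC => [|n IHn] F G FC GC //.
by rewrite !iterSr total_deriv_der.1 IHn //; apply: fps_Czw_deriv.
Qed.

(** Both sides have the same constant term, and their derivatives agree by
    Leibniz' rule and induction on the order. *)
Lemma taylor_valueM F G : fps_Czw F -> fps_Czw G -> V (F * G) = V F * V G.
Proof.
move=> FC GC; apply: fpsP => n.
elim: n F G FC GC => [|n IHn] F G FC GC.
  rewrite fcoefM big_ord_recl big_ord0 addr0 subnn !taylor_value_coef0.
  by rewrite fcoefM big_ord_recl big_ord0 addr0 ldiagM.
apply: (@laurent_mulrnI n); rewrite -[LHS]/(fderiv (V (F * G)) n).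
rewrite -[RHS]/(fderiv (V F * V G) n) (fderiv_derivation _).2 !fderiv_taylor.
have [F'C G'C] := (fps_Czw_deriv FC, fps_Czw_deriv GC).
rewrite total_deriv_der.2 taylor_valueD; try exact: fps_CzwM.
by rewrite !fcoefD !IHn.
Qed.

Lemma taylor_value_const u : dz u = 0 -> V (fconst u) = fconst (ldiag u).
Proof.
move=> du; have D0 : total_deriv (fconst u) = 0.
  by rewrite /total_deriv fderiv_const fmap_fconst ?(derivation0 dz_der) // du
    raddf0 addr0.
apply: fps_deriv_inj; first by rewrite taylor_value_coef0.
rewrite fderiv_taylor D0 fderiv_const; apply: fpsP => n /=.
have -> : iter n total_deriv 0 = 0.
  by elim: n => //= n ->; rewrite (derivation0 total_deriv_der).
by rewrite ldiag0 scaler0.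
Qed.

Lemma taylor_value_zero : V 0 = 0.
Proof.
rewrite -[0 in LHS](raddf0 (@fconst L2)) taylor_value_const.
  by rewrite ldiag0 raddf0.
exact: derivation0 dz_der.
Qed.

Lemma taylor_value1 : V 1 = 1.
Proof.
rewrite -[1 in LHS]/(fconst 1) taylor_value_const.
  by rewrite -[1]/(lconst 1) ldiag_lconst.
exact: derivation1 dz_der.
Qed.

Lemma taylor_value_sum (I : Type) (r : seq I) (P : pred I) (F : I -> fps L2) :
  (forall i, fps_Czw (F i)) ->
  V (\sum_(i <- r | P i) F i) = \sum_(i <- r | P i) V (F i).
Proof.
move=> FC.
suff [] : fps_Czw (\sum_(i <- r | P i) F i) /\
  V (\sum_(i <- r | P i) F i) = \sum_(i <- r | P i) V (F i) by [].
apply: (big_rec2 (fun x y => fps_Czw y /\ V y = x)).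
  by split; [move=> n; apply: in_Czw0 | apply: taylor_value_zero].
move=> i x y _ [yC <-]; split; first exact: fps_CzwD.
by rewrite taylor_valueD.
Qed.

Lemma taylor_valueX F k : fps_Czw F -> V (F ^+ k) = V F ^+ k.
Proof.
move=> FC; elim: k => [|k IHk]; first exact: taylor_value1.
by rewrite !exprS taylor_valueM ?IHk //; apply: fps_CzwX.
Qed.

Lemma taylor_value_fX : V (fX L2) = fX L1.
Proof.
apply: fps_deriv_inj; first by rewrite taylor_value_coef0 ldiag0.
have fX' (A : comNzRingType) : fderiv (fX A) = 1.
  by apply: fpsP => -[|n]; rewrite //= mul0rn.
rewrite fderiv_taylor fX' /total_deriv fX'.
have -> : fmap_fps dz (fX L2) = 0.
  apply: fpsP => -[|[|n]] /=; rewrite ?(derivation0 dz_der) //.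
  exact: derivation1 dz_der.
by rewrite addr0 taylor_value1.
Qed.

(** The value of F satisfies a homogeneous linear differential equation with
    zero initial condition, and such an equation has only the zero
    solution. *)
Lemma taylor_value_eq0 F B : fps_Czw F -> fps_Czw B ->
  total_deriv F = B * F -> ldiag (F 0%N) = 0 -> V F = 0.
Proof.
move=> FC BC DF F0; apply: fpsP; elim/ltn_ind=> -[_|n IHn].
  by rewrite taylor_value_coef0.
apply: (@laurent_mulrnI n); rewrite mul0rn -[LHS]/(fderiv (V F) n).
rewrite fderiv_taylor DF taylor_valueM // fcoefM big1 // => i _.
by rewrite IHn ?mulr0 // ltnS leq_subr.
Qed.

(** exp(hbar d0) z. *)
Definition flow : fps L1 := Fps (fun n => (n`!%:R^-1 : C) *: iter n d0 (lX C)).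

Lemma taylor_value_lconst f :
  V (fconst (lconst f)) = Fps (fun n => (n`!%:R^-1 : C) *: iter n d0 f).
Proof.
apply: fpsP => n /=; congr (_ *: _).
suff -> : iter n total_deriv (fconst (lconst f)) = fconst (lconst (iter n d0 f)).
  by rewrite /= ldiag_lconst.
elim: n => //= n ->; rewrite /total_deriv fderiv_const add0r.
rewrite fmap_fconst ?(derivation0 dz_der) // lmap_lconst //.
exact: derivation0 d0_der.
Qed.

Lemma taylor_value_expz (m : int) : V (fconst (lconst (lX C ^ m))) = flow ^ m.
Proof.
have zC (f : L1) : fps_Czw (fconst (lconst f)) by apply/fps_Czw_const/in_Czw_lconst.
have pow k : V (fconst (lconst (lX C ^+ k))) = flow ^+ k.
  by rewrite !rmorphXn /= taylor_valueX // taylor_value_lconst.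
case: m => k; first exact: pow.
rewrite NegzE -!exprnN; apply/esym/mulr1_eq.
rewrite -pow -taylor_valueM // -!rmorphM /= mulfV ?rmorph1 ?taylor_value1 //.
apply/eqP => /(congr1 (fun w => lcoef w k.+1)) /eqP.
by rewrite lXnE eqxx oner_eq0.
Qed.

(** a z^m w^n *)
Definition bimono (a : C) (n m : int) : L2 :=
  lshift n (fconst (lshift m (fconst a))).

Lemma bimonoE a n m n' m' :
  bimono a n m n' m' = if (n' == n) && (m' == m) then a else 0.
Proof.
by rewrite lshift_fconst; case: (n' == n) => //; apply: lshift_fconst.
Qed.

Lemma bimono_bishift a n m : bimono a n m = bishift n m (fconst (fconst a)).
Proof.
congr (lshift _ _); apply: fpsP => -[|k] //=.
by rewrite raddf0.
Qed.

Lemma in_Czw_bimono a n m : in_Czw (bimono a n m).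
Proof. by rewrite bimono_bishift; apply: in_Czw_bishift. Qed.

Lemma taylor_value_bimono a n m :
  V (fconst (bimono a n m)) = fconst (a *: lX C ^ n) * flow ^ m.
Proof.
have -> : bimono a n m = lconst (lX C ^ m) * bimono a n 0.
  by rewrite lXz !bimono_bishift lconst_bishift bishiftM add0r addr0 mul1r.
rewrite rmorphM taylor_valueM; first last.
- exact/fps_Czw_const/in_Czw_bimono.
- exact/fps_Czw_const/in_Czw_lconst.
rewrite taylor_value_expz mulrC; congr (_ * _).
rewrite taylor_value_const; last first.
  rewrite lmap_lshift ?(derivation0 d0_der) // fmap_fconst ?(derivation0 d0_der) //.
  by rewrite -[lshift 0 _]/(lconst a) d0_const !raddf0.
congr fconst; rewrite bimono_bishift ldiag_bishift addr0 diag_fps_const.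
apply: laurentP => k; rewrite lcoefZ lXz !lshift_fconst.
by case: eqP; rewrite ?mulr1 ?mulr0.
Qed.

(** The truncation of u to the degrees between -N and N - 1 in each
    variable. *)
Definition box (N : nat) u : L2 :=
  \sum_(i < N.*2) \sum_(j < N.*2)
    let n := i%:Z - N%:Z in let m := j%:Z - N%:Z in bimono (u n m) n m.

Lemma sum_box (N : nat) (F : int -> C) (k : int) :
  \sum_(i < N.*2) (if k == i%:Z - N%:Z then F (i%:Z - N%:Z) else 0) =
  if - N%:Z <= k < N%:Z then F k else 0.
Proof.
rewrite -big_mkcond; case: ifP => kN; last first.
  by rewrite big1 // => i /eqP ki; have := ltn_ord i; lia.
have iN : (`|(k + N%:Z)%R|%N < N.*2)%N by lia.
rewrite (big_pred1 (Ordinal iN)) /=; first by congr F; lia.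
by move=> i; apply/eqP/eqP => [ki|->] /=; [apply: val_inj => /= |]; lia.
Qed.

Lemma boxE N u n m : box N u n m =
  if (- N%:Z <= n < N%:Z) && (- N%:Z <= m < N%:Z) then u n m else 0.
Proof.
rewrite /box lcoef_sum.
transitivity (\sum_(i < N.*2) if n == i%:Z - N%:Z then
  (if - N%:Z <= m < N%:Z then u (i%:Z - N%:Z) m else 0) else 0); last first.
  rewrite (sum_box N (fun i => if - N%:Z <= m < N%:Z then u i m else 0)).
  by case: ifP.
rewrite lcoef_sum; apply: eq_bigr => i _.
rewrite lcoef_sum lcoef_sum; case: eqP => ni; last first.
  by rewrite big1 // => j _; rewrite bimonoE ifF //; lia.
rewrite -(sum_box N (fun j => u (i%:Z - N%:Z) j)).
apply: eq_bigr => j _; rewrite bimonoE.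
by rewrite ni eqxx.
Qed.

(** Truncation converges for the total degree: a missing term has degree at
    least N in one variable, and a bounded degree from below in the other.
    When N is small the terms below -N may be missing as well, whence a
    multiple of the bound on the poles. *)
Lemma box_order u : in_Czw u -> exists M : nat, forall N : nat,
  order_ge (N%:Z - M%:Z) (u - box N u).
Proof.
move=> [b ub]; have [a ua] := lcoefP u.
exists (3 * (`|a|%N + `|b|%N))%N => N n m nm.
have -> : (u - box N u) n m = u n m - box N u n m by [].
rewrite boxE; case: ifP => nN; first by rewrite subrr.
rewrite subr0; have [na|na] := ltP n a; first by rewrite ua.
have [mb|mb] := ltP m b; first by rewrite ub.
lia.
Qed.

Lemma order_ge_dz p u : order_ge p u -> order_ge (p - c%:Z) (dz u).
Proof.
move=> up n m nm; rewrite dzE; apply: (@d0_lt _ (p - n)); last lia.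
by move=> k kp; apply: up; lia.
Qed.

Lemma order_geW p q u : q <= p -> order_ge p u -> order_ge q u.
Proof. by move=> qp up n m nm; apply: up; lia. Qed.

Lemma order_ge_deriv p j F : (forall k, (k <= j.+1)%N -> order_ge p (F k)) ->
  forall k, (k <= j)%N -> order_ge (p - c%:Z) (total_deriv F k).
Proof.
move=> Fp k kj n m nm.
have -> : total_deriv F k n m = F k.+1 n m *+ k.+1 + dz (F k) n m.
  by rewrite -lcoefMn; congr (lcoef _ m + _); apply: lcoefMn.
have -> : F k.+1 n m = 0 by apply: Fp; lia.
rewrite mul0rn add0r.
by apply: (order_ge_dz (Fp k _)); lia.
Qed.

Lemma order_ge_iter p j F : (forall k, (k <= j)%N -> order_ge p (F k)) ->
  order_ge (p - (j * c)%:Z) (iter j total_deriv F 0%N).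
Proof.
elim: j p F => [|j IHj] p F Fp; first by apply: order_geW (Fp 0%N _); lia.
rewrite iterSr; apply: order_geW (IHj (p - c%:Z) _ _); first lia.
exact: order_ge_deriv.
Qed.

Lemma taylor_value_lt p j F : fps_Czw F ->
  (forall k, (k <= j)%N -> order_ge p (F k)) ->
  forall n, n < p - (j * c)%:Z -> V F j n = 0.
Proof.
move=> FC Fp n np; rewrite lcoefZ.
by rewrite (ldiag_lt (fps_Czw_iter _ FC _) (order_ge_iter Fp)) ?mulr0.
Qed.

(** The sum of truncated values is the value of the truncation, as taking
    values is a ring morphism that sends z^m to the m-th power of the flow. *)
Lemma truncated_valueE F N :
  truncated_value F flow N = V (\sum_(k < N) fX L2 ^+ k * fconst (box N (F k))).
Proof.
have bC u : in_Czw (box N u).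
  by apply: in_Czw_sum => i; apply: in_Czw_sum => j; apply: in_Czw_bimono.
rewrite taylor_value_sum; last first.
  by move=> k; apply: fps_CzwM; [exact/fps_CzwX/fps_Czw_X|exact/fps_Czw_const].
apply: eq_bigr => k _; rewrite taylor_valueM; first last.
- exact/fps_Czw_const.
- exact/fps_CzwX/fps_Czw_X.
rewrite taylor_valueX; last exact: fps_Czw_X.
rewrite taylor_value_fX raddf_sum taylor_value_sum; last first.
  by move=> i; apply/fps_Czw_const/in_Czw_sum => j; apply: in_Czw_bimono.
rewrite mulr_sumr; apply: eq_bigr => i _.
rewrite raddf_sum taylor_value_sum; last first.
  by move=> j; apply/fps_Czw_const/in_Czw_bimono.
rewrite mulr_sumr; apply: eq_bigr => j _ /=.
by rewrite taylor_value_bimono mulrA.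
Qed.

(** The coefficient of hbar^j of the value involves at most j applications of
    d_z to finitely many coefficients of F, so it is continuous for the
    filtration by total degree; truncations are dense by [box_order]. *)
Lemma taylor_valueP F : fps_Czw F -> value_at F flow (V F).
Proof.
move=> FC j p.
have [M FM] : exists M : nat, forall k, (k <= j)%N -> forall N : nat,
    order_ge (N%:Z - M%:Z) (F k - box N (F k)).
  elim: j => [|j [M IHj]].
    have [M FM] := box_order (FC 0%N); exists M => k.
    by rewrite leqn0 => /eqP ->.
  have [M' FM'] := box_order (FC j.+1); exists (M + M')%N => k kj N.
  have [kj1|kj1] := leqP k j; first by apply: order_geW (IHj k kj1 N); lia.
  have -> : k = j.+1 by lia.
  by apply: order_geW (FM' N); lia.
exists (j + M + j * c + `|p|)%N.+1 => N Np q qp.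
have bC u : in_Czw (box N u).
  by apply: in_Czw_sum => i; apply: in_Czw_sum => l; apply: in_Czw_bimono.
rewrite truncated_valueE; set H := \sum_(k < N) _.
have HC : fps_Czw H.
  apply: fps_Czw_sum => k.
  by apply: fps_CzwM; [exact/fps_CzwX/fps_Czw_X|exact/fps_Czw_const].
have HE k : (k <= j)%N -> H k = box N (F k).
  move=> kj; have kN : (k < N)%N by lia.
  rewrite /H fcoef_sum (bigD1 (Ordinal kN)) // fXnME leqnn subnn.
  rewrite big1 => [|i ik]; first exact: addr0.
  rewrite fXnME; case: leqP => // ki.
  rewrite /= ifN //; apply: contra ik => /eqP ik.
  by apply/eqP/val_inj => /=; lia.
have FHC : fps_Czw (F - H) by apply: fps_CzwD => //; apply: fps_CzwN.
have -> : V F = V (F - H) + V H by rewrite -taylor_valueD ?subrK.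
rewrite fcoefD lcoefD (@taylor_value_lt (N%:Z - M%:Z) j (F - H)) ?add0r //; last lia.
by move=> k kj; rewrite fcoefB HE //; apply: FM.
Qed.

End Taylor.

(** * Evaluation of differential polynomials *)

Section DifferentialEvaluation.
Variables (C : numFieldType) (S : comNzRingType) (f : {rmorphism C -> S}).
Variable X : nat -> S.

Definition monom_value (m : cmonom nat) : S :=
  \prod_(i <- finsupp m) X i ^+ m i.

Lemma monom_valueEw (E : {fset nat}) (m : cmonom nat) : (finsupp m `<=` E)%fset ->
  monom_value m = \prod_(i <- E) X i ^+ m i.
Proof.
move=> le; rewrite /monom_value (big_fset_incl _ le) // => i _.
by rewrite -cmE_neq0 negbK => /eqP ->.
Qed.

Lemma monom_value1 : monom_value mone = 1.
Proof. by rewrite /monom_value mdom1 big_seq_fset0. Qed.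

Lemma monom_valueM : {morph monom_value : m1 m2 / mmul m1 m2 >-> m1 * m2}.
Proof.
move=> m1 m2; pose E := (finsupp m1 `|` finsupp m2)%fset.
rewrite !(@monom_valueEw E) ?fsubsetUl ?fsubsetUr ?mdomD // -big_split.
by apply: eq_bigr => i _; rewrite cmM exprD.
Qed.

HB.instance Definition _ := monalg.isMultiplicative.Build (cmonom nat) S
  monom_value (monom_valueM, monom_value1).

Definition poly_value : gpoly C -> S := mmap f monom_value.

Lemma poly_valueE p : poly_value p = mmap f monom_value p. Proof. by []. Qed.

Lemma poly_valueD : {morph poly_value : p q / p + q}.
Proof. exact: mmapD. Qed.

Lemma poly_value0 : poly_value 0 = 0.
Proof. exact: (mmap0 (f := f)). Qed.

Lemma poly_valueN : {morph poly_value : p / - p}.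
Proof. exact: mmapN. Qed.

Lemma poly_valueMn n : {morph poly_value : p / p *+ n}.
Proof. exact: mmapMn. Qed.

Lemma poly_valueM : {morph poly_value : p q / p * q}.
Proof. exact: (mmap_is_multiplicative (f := f) (h := monom_value)).1. Qed.

Lemma poly_value_sum (I : Type) (r : seq I) (P : pred I) (F : I -> gpoly C) :
  poly_value (\sum_(i <- r | P i) F i) = \sum_(i <- r | P i) poly_value (F i).
Proof. exact: (big_morph poly_value poly_valueD poly_value0). Qed.

Lemma poly_value1 : poly_value 1 = 1.
Proof. exact: (mmap1 (f := f) (h := monom_value)). Qed.

Lemma poly_valueU (c : C) m : poly_value (mkmalgU m c) = f c * monom_value m.
Proof. exact: (mmapU (f := f)). Qed.

Lemma monom_value_ucm i : monom_value (ucm i) = X i.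
Proof. by rewrite /monom_value mdomU big_seq_fset1 cmUU expr1. Qed.

Lemma poly_value_gvar i : poly_value (gvar C i) = X i.
Proof. by rewrite poly_valueU rmorph1 mul1r monom_value_ucm. Qed.

Variable d : S -> S.
Hypothesis d_der : is_derivation d.
Hypothesis d_const : forall c, d (f c) = 0.
Hypothesis dX : forall i, d (X i) = X i.+1.

Lemma derivation_prod (I : eqType) (r : seq I) (F : I -> S) : uniq r ->
  d (\prod_(i <- r) F i) =
  \sum_(i <- r) d (F i) * \prod_(j <- r | j != i) F j.
Proof.
elim: r => [|k r IHr] /=; first by rewrite !big_nil (derivation1 d_der).
move=> /andP[kr ru]; rewrite !big_cons d_der.2 IHr // eqxx /=.
congr (_ * _ + _).
  rewrite big_seq [RHS]big_seq_cond; apply: eq_bigl => j.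
  by have [->|] := eqVneq j k; rewrite ?andbT ?(negPf kr).
rewrite mulr_sumr [LHS]big_seq [RHS]big_seq; apply: eq_bigr => j jr.
rewrite big_cons ifT; first by rewrite mulrCA.
by apply: contraNneq kr => ->.
Qed.

Lemma derivation_monom_value m : d (monom_value m) =
  \sum_(i <- finsupp m)
    (X i.+1 * monom_value (divcm m (ucm i))) *+ m i.
Proof.
rewrite derivation_prod ?fset_uniq // big_seq [RHS]big_seq.
apply: eq_bigr => i im; rewrite (derivationX d_der) dX mulrnAl.
congr (_ *+ _); rewrite [X i ^+ _ * _]mulrC -mulrA; congr (_ * _).
rewrite (@monom_valueEw (finsupp m)); last first.
  apply/fsubsetP => j; rewrite -!cmE_neq0 divcmE; apply: contraNneq => ->.
  by rewrite sub0n.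
rewrite [RHS](bigD1_seq i) //= divcmE cmUU subn1; congr (_ * _).
by apply: eq_bigr => j ji; rewrite divcmE cmU eq_sym (negPf ji) subn0.
Qed.

(** If X_(i+1) is the derivative of X_i and constants are killed, then
    evaluation turns D = \sum_i gamma_(i+1) d/dgamma_i into d; it is enough to
    check this on monomials. *)
Lemma poly_value_gderiv p : poly_value (gderiv p) = d (poly_value p).
Proof.
rewrite poly_value_sum [in RHS]poly_valueE mmapE (derivation_sum d_der).
apply: eq_bigr => m _; rewrite poly_value_sum d_der.2 d_const mul0r add0r.
rewrite derivation_monom_value mulr_sumr; apply: eq_bigr => i _.
rewrite poly_valueU raddfMn /= mulrnAl mulrnAr; congr (_ *+ _).
by rewrite -monom_value_ucm -monom_valueM.
Qed.

Lemma fmap_poly_value_psi (psi : fps (gpoly C)) : is_psi psi ->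
  let P := fmap_fps poly_value psi in
  fderiv P = fmap_fps d P - 1 - fconst (X 0) * P ^+ 2.
Proof.
move=> [_ psiE] P; apply: fpsP => n.
have -> : fderiv P n = poly_value (fderiv psi n) by rewrite /= poly_valueMn.
rewrite psiE !fcoefB !poly_valueD !poly_valueN.
congr (_ - _ - _); first exact: poly_value_gderiv.
  by case: n => [|n]; [exact: poly_value1|exact: poly_value0].
rewrite !fconstME poly_valueM poly_value_gvar; congr (_ * _).
rewrite !expr2 !fcoefM poly_value_sum; apply: eq_bigr => i _.
exact: poly_valueM.
Qed.

End DifferentialEvaluation.

(** * The kernel of a pair of dual bases *)

Section CauchyKernel.
Variables (C : numFieldType) (hs : laurent C).
Local Notation L2 := (laurent (laurent C)).

(** The expansion of 1 / ((z - w) h(z)) in the region |w| < |z|. *)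
Definition cauchy_kernel : L2 := lshift 0 (Fps (fun n => lX C ^ (- 1 - n%:Z) / hs)).

Lemma cauchy_kernelE n :
  cauchy_kernel n = if 0 <= n then lX C ^ (- 1 - n) / hs else 0.
Proof. by rewrite lshiftE subr0; case: n. Qed.

Lemma diff_cauchy_kernel : diff_zw C * cauchy_kernel = lconst hs^-1.
Proof.
have -> : diff_zw C = lshift 0 (fconst (lX C) - fX _).
  rewrite raddfB; congr (_ - _); apply: laurentP => n; rewrite !lshiftE.
  by case: n => [[|[|n]]|n].
rewrite /cauchy_kernel lshiftM; congr (lshift _ _); apply: fpsP => n.
rewrite mulrBl fcoefB fconstME fXME mulrA lXz [lX C * _]lshiftM mulr1.
case: n => [|n].
  have -> : 1 + (- 1 - 0%N%:Z) = 0 by lia.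
  by rewrite -lXz expr0z mul1r subr0.
have -> : 1 + (- 1 - n.+1%:Z) = - 1 - n%:Z by lia.
by rewrite /= lXz subrr.
Qed.

End CauchyKernel.

Section Kernel.
Variables (C : numFieldType) (I : finType).
Local Notation K := (I -> laurent C).
Local Notation L2 := (laurent (laurent C)).
Variable h : K.

Lemma K_sumE (J : Type) (r : seq J) (P : pred J) (F : J -> K) s :
  (\sum_(j <- r | P j) F j) s = \sum_(j <- r | P j) F j s.
Proof. exact: (big_morph (fun x : K => x s)). Qed.

(** Up to integral elements L is spanned by finitely many vectors. *)
Lemma poles_bounded (L : set K) : finite_codim (L `&` integral_K (I:=I)) L ->
  exists M : int, forall x, L x -> forall s n, n < M -> x s n = 0.
Proof.
move=> [m [v Lv]].
have /choice[N vN] : forall i : 'I_m * I, exists N : int,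
    forall n, n < N -> v i.1 i.2 n = 0 by move=> i; apply: lcoefP.
pose M := - (\sum_i `|N i|%N)%:Z.
exists M => x /Lv[c [_ xO]] s n nM.
have := xO s n; rewrite lcoefD lcoefN K_sumE lcoef_sum.
have n0 : n < 0 by rewrite /M in nM; lia.
rewrite big1 ?subr0 => [->//|i _]; rewrite lcoefZ (vN (i, s)) ?mulr0 //.
have : (`|N (i, s)| <= \sum_i `|N i|)%N by rewrite (bigD1 (i, s)) //= leq_addr.
by rewrite /M in nM; lia.
Qed.

Lemma pairingDl f f' g : pairing h (f + f') g = pairing h f g + pairing h f' g.
Proof.
rewrite /pairing -big_split; apply: eq_bigr => s _ /=.
by rewrite -[RHS]/((f s * g s * h s + f' s * g s * h s) (- 1)) -!mulrDl.
Qed.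

Lemma pairingZl a f g : pairing h (a *: f) g = a * pairing h f g.
Proof.
rewrite /pairing mulr_sumr; apply: eq_bigr => s _.
have -> : (a *: f) s = lconst a * f s by [].
by rewrite -!mulrA lconstME.
Qed.

Definition single s (f : laurent C) : K := fun t => if t == s then f else 0.

Lemma pairing_single s f g : pairing h (single s f) g = (f * g s * h s) (- 1).
Proof.
rewrite /pairing (bigD1 s) // /single eqxx big1 => [|t /negPf ->].
  exact: addr0.
by rewrite !mul0r.
Qed.

(** If h vanished at s, the component of K at s would be orthogonal to
    everything, hence contained in the maximal isotropic L, where pole orders
    are bounded. *)
Lemma weight_neq0 (L : set K) (M : int) s : maximal_isotropic h L ->
  (forall x, L x -> forall s n, n < M -> x s n = 0) -> h s != 0.
Proof.
move=> [[L0 Llin] Liso Lmax] LM; apply/eqP => hs0.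
pose L' : set K := [set x | exists2 y, L y & forall t, t != s -> x t = y t].
have LL' : L `<=` L' by move=> x Lx; exists x.
have pairE x x' y y' : (forall t, t != s -> x t = y t) ->
    (forall t, t != s -> x' t = y' t) -> pairing h x x' = pairing h y y'.
  move=> xy xy'; apply: eq_bigr => t _.
  by have [->|ts] := eqVneq t s; rewrite ?hs0 ?mulr0 // xy ?xy'.
have L'E : L' = L.
  apply: Lmax => //; last first.
    move=> x x' [y Ly xy] [y' Ly' xy'].
    by rewrite (pairE _ _ _ _ xy xy') Liso.
  split=> [|a x x' [y Ly xy] [y' Ly' xy']]; first by exists 0.
  exists (a *: y + y'); first exact: Llin.
  move=> t ts; rewrite -[LHS]/(a *: x t + x' t) -[RHS]/(a *: y t + y' t).
  by rewrite xy ?xy'.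
have Ls : L (single s (lX C ^ (M - 1))).
  by rewrite -L'E; exists 0 => // t /negPf ts; rewrite /single ts.
have M1 : M - 1 < M by lia.
have /eqP := LM _ Ls s _ M1.
by rewrite /single eqxx lXz lshift_fconst eqxx oner_eq0.
Qed.

Variables (B L : set K) (e f : nat -> K) (G : I -> I -> L2).
Hypothesis e_basis : linear_basis B e.
Hypothesis fL : forall i, L (f i).
Hypothesis L_iso : isotropic h L.
Hypothesis ef_dual : forall i j, pairing h (e i) (f j) = - (i == j)%:R.
Hypothesis BL : complement B L.
Hypothesis G_sum : is_tensor_sum e f G.
Variable M : int.
Hypothesis LM : forall x, L x -> forall s n, n < M -> x s n = 0.
Variable s : I.
Hypothesis hs_neq0 : h s != 0.

(** Write g = z^(- 1 - n) / h, placed at s, as x + y with x in B and y in L.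
    The coefficient of w^n in f_i is the pairing of g with f_i; it is that of
    x, since L is isotropic, and so minus the i-th coordinate of x. Therefore
    the coefficient of w^n in G is - x. *)
Lemma kernel_coef n : exists2 y : K, L y & G s s n = y s - lX C ^ (- 1 - n) / h s.
Proof.
pose g : K := single s (lX C ^ (- 1 - n) / h s).
have [x [y [Bx Ly gE]]] := BL.2 g.
have [_ /(_ x Bx)[m [c xE]] _] := e_basis.
have gs : g s = lX C ^ (- 1 - n) / h s by rewrite /g /single eqxx.
have pair_g i : pairing h g (f i) = f i s n.
  rewrite pairing_single mulrAC divfK // lXz.
  have [N [k ->]] := lshift_ex (f i s).
  rewrite lshiftM mul1r !lshiftE; have -> : - 1 - (- 1 - n + N) = n - N by lia.
  by [].
have fE i : f i s n = if (i < m)%N then - c i else 0.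
  rewrite -pair_g gE pairingDl (L_iso Ly (fL i)) addr0 xE.
  have -> : pairing h (\sum_(j < m) c j *: e j) (f i) =
      \sum_(j < m) c j * pairing h (e j) (f i).
    apply: (big_ind2 (fun x y => pairing h x (f i) = y)).
    - by rewrite -[0 in LHS](scale0r 0) pairingZl mul0r.
    - by move=> x1 x2 y1 y2 <- <-; rewrite pairingDl.
    - by move=> j _; rewrite pairingZl.
  under eq_bigr do rewrite ef_dual mulrN.
  case: ifP => im; last first.
    rewrite big1 // => j _; have := ltn_ord j; case: eqP => [->|_ _].
      by rewrite im.
    by rewrite mulr0n mulr0 oppr0.
  rewrite (bigD1 (Ordinal im)) //= eqxx mulr1 big1 ?addr0 // => j ji.
  have -> : (j == i :> nat) = false.
    by apply: contraNF ji => /eqP ji; apply/eqP/val_inj.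
  by rewrite mulr0 oppr0.
exists y => //.
(* The partial sums are stationary beyond the number m of coordinates of x. *)
have [k0 Gk] := G_sum s s (n + 1).
have mk : (m <= maxn k0 m)%N by rewrite leq_maxr.
rewrite -(Gk (maxn k0 m)) ?leq_maxl //; last lia.
have -> : y s - lX C ^ (- 1 - n) / h s = - x s.
  by rewrite -gs gE opprD addrCA subrr addr0.
rewrite lcoef_sum.
have tE i : tensor (e i s) (f i s) n = f i s n *: e i s by rewrite lmapE // scale0r.
under eq_bigr do rewrite tE fE.
rewrite xE K_sumE -sumrN (big_ord_widen _ (fun i => - (c i *: e i s)) mk).
rewrite [RHS]big_mkcond; apply: eq_bigr => i _.
by case: ifP => _; rewrite ?scale0r // scaleNr.
Qed.

(** For n >= 0 the coefficient of w^n is an element of L by [kernel_coef], and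
    pole orders in L are bounded. For n < 0 the Cauchy kernel contributes
    nothing, and only finitely many coefficients of G are nonzero. *)
Lemma in_Czw_kernel : in_Czw (G s s + cauchy_kernel (h s)).
Proof.
have [N GN] := lcoefP (G s s).
have /choice[b Gb] : forall n, exists b : int, forall m, m < b -> G s s n m = 0.
  by move=> n; apply: lcoefP.
pose b0 := - (\sum_(i < `|N|) `|b (- i.+1%:Z)|%N)%:Z.
exists (Num.min M b0) => n m; rewrite lt_min => /andP[mM mb].
have -> : (G s s + cauchy_kernel (h s)) n m =
  G s s n m + cauchy_kernel (h s) n m by [].
rewrite cauchy_kernelE; case: ifPn => n0.
  have [y Ly ->] := kernel_coef n.
  have -> : (y s - lX C ^ (- 1 - n) / h s) m + (lX C ^ (- 1 - n) / h s) m = y s m.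
    by rewrite lcoefD lcoefN subrK.
  exact: LM mM.
rewrite addr0; have [nN|nN] := ltP n N; first by rewrite GN.
case: n n0 nN => [//|n] _ nN; rewrite NegzE in nN *.
have nN' : (n < `|N|)%N by lia.
rewrite Gb //; apply: lt_le_trans mb _; rewrite /b0.
have : (`|b (- n.+1%:Z)| <= \sum_(i < `|N|) `|b (- i.+1%:Z)|)%N.
  by rewrite (bigD1 (Ordinal nN')) //= leq_addr.
lia.
Qed.

End Kernel.

(** * The equation satisfied by (z - w)(1 + psi G) *)

Section LocalDerivation.
Variables (C : numFieldType) (hs : laurent C).
Local Notation L1 := (laurent C).
Local Notation L2 := (laurent (laurent C)).

Lemma deriv_at_der : is_derivation (deriv_at hs).
Proof.
have [dD dM] := lderiv_derivation C; split=> f g; rewrite /deriv_at.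
  by rewrite dD mulrDl.
by rewrite dM mulrDl mulrA mulrAC.
Qed.

Lemma lderiv_lconst (c : C) : lderiv (lconst c) = 0.
Proof.
apply: laurentP => n; rewrite lderivE lconstE; case: eqP => [->|_].
  by rewrite mulr0z.
by rewrite mul0rz.
Qed.

Lemma deriv_at_lconst (c : C) : deriv_at hs (lconst c) = 0.
Proof. by rewrite /deriv_at lderiv_lconst mul0r. Qed.

Lemma deriv_atZ (a : C) f : deriv_at hs (a *: f) = a *: deriv_at hs f.
Proof. by rewrite [LHS]deriv_at_der.2 deriv_at_lconst mul0r add0r. Qed.

Lemma deriv_at_lX : deriv_at hs (lX C) = hs^-1.
Proof. by rewrite /deriv_at lderivX mul1r. Qed.

Local Notation dz := (lmap (deriv_at hs) : L2 -> L2).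

Lemma dz_diff : dz (diff_zw C) = lconst hs^-1.
Proof.
have dd := lmap_derivation deriv_at_der; have d0 := derivation0 deriv_at_der.
rewrite (derivationB dd) (lmap_lX deriv_at_der) subr0.
by rewrite lmap_lconst // deriv_at_lX.
Qed.

Variable a : C.
Definition scaled_deriv (f : L1) : L1 := a *: deriv_at hs f.

Lemma scaled_deriv_der : is_derivation scaled_deriv.
Proof.
have [dD dM] := deriv_at_der; split=> f g; rewrite /scaled_deriv.
  by rewrite dD scalerDr.
rewrite dM scalerDr; congr (_ + _); rewrite /GRing.scale /= /lscale; ring.
Qed.

Lemma scaled_deriv_lconst c : scaled_deriv (lconst c) = 0.
Proof. by rewrite /scaled_deriv deriv_at_lconst scaler0. Qed.

Lemma scaled_deriv_lt : exists c : nat, forall (f : L1) p,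
  (forall n, n < p -> f n = 0) -> forall n, n < p - c%:Z -> scaled_deriv f n = 0.
Proof.
have [e he] := lcoefP hs^-1; exists (1 + `|e|)%N => f p fp n np.
rewrite lcoefZ (@lcoefM_lt _ _ _ (p - 1) e) ?mulr0 //; last lia.
exact: lderiv_lt.
Qed.

Lemma lmap_scaled_deriv u : lmap scaled_deriv u = lconst (lconst a) * dz u.
Proof.
apply: laurentP => n; rewrite lconstME !lmapE //.
  exact: derivation0 deriv_at_der.
exact: derivation0 scaled_deriv_der.
Qed.

Lemma iter_scaled_deriv n f :
  iter n scaled_deriv f = a ^+ n *: iter n (deriv_at hs) f.
Proof.
elim: n => [|n IHn] /=; first by rewrite scale1r.
by rewrite IHn /scaled_deriv deriv_atZ scalerA -exprS.
Qed.

End LocalDerivation.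

Lemma flow_exp_coordinate (C : numFieldType) (I : finType) (h : I -> laurent C)
  a s : flow (scaled_deriv (h s) a) = exp_coordinate h a s.
Proof.
by apply: fpsP => n /=; rewrite iter_scaled_deriv scalerA mulrC.
Qed.

Section DiagonalZeros.
Variables (C : numFieldType) (hs : laurent C) (hs_neq0 : hs != 0).
Local Notation L1 := (laurent C).
Local Notation L2 := (laurent (laurent C)).
Local Notation D := (diff_zw C).
Local Notation dz := (lmap (deriv_at hs) : L2 -> L2).
(** u is the pole of - G: in the application it is the Cauchy kernel. *)
Variables (G u gamma : L2).
Hypothesis Du : D * u = lconst hs^-1.
Hypothesis GuC : in_Czw (G + u).
Hypothesis dG : dz G = gamma + G ^+ 2.
Hypothesis gammaC : in_Czw gamma.

(** This exhibits the simple pole of G on the diagonal and its residue. *)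
Lemma DG_eq : D * G = D * (G + u) - lconst hs^-1.
Proof. by rewrite -Du; ring. Qed.

Lemma in_Czw_DG : in_Czw (D * G).
Proof.
rewrite DG_eq; apply: in_CzwD; first by apply: in_CzwM => //; apply: in_Czw_diff.
by apply: in_CzwN; apply: in_Czw_lconst.
Qed.

Lemma ldiag_DG : ldiag (D * G) = - hs^-1.
Proof.
have DC := in_Czw_diff C; have cC := in_Czw_lconst hs^-1.
rewrite DG_eq ldiagB ?ldiagM ?ldiag_diff ?mul0r ?sub0r ?ldiag_lconst //.
exact: in_CzwM.
Qed.

Variables (a : C) (P : fps L2).
Hypothesis PC : fps_Czw P.
Hypothesis P0 : P 0%N = 0.

(** For P = psi_+ or psi_- this is, up to an invertible series, the numerator
    or the denominator of q(z, w). *)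
Definition factor : fps L2 := fconst D * (1 + P * fconst G).
Local Notation value := (taylor_value (scaled_deriv hs a)).

Lemma fps_Czw_factor : fps_Czw factor.
Proof.
have -> : factor = fconst D + P * fconst (D * G) by rewrite /factor rmorphM; ring.
apply: fps_CzwD; first exact/fps_Czw_const/in_Czw_diff.
by apply: fps_CzwM => //; apply/fps_Czw_const/in_Czw_DG.
Qed.

Lemma factor_value0 : value factor 0%N = 0.
Proof.
rewrite taylor_value_coef0 fconstME fcoefD [fcoef (P * _) _]fcoefM.
by rewrite big_ord_recl big_ord0 P0 mul0r !addr0 mulr1 ldiag_diff.
Qed.

Lemma factor_value1 (p : C) : P 1%N = lconst (lconst p) ->
  value factor 1%N = (a - p) *: hs^-1.
Proof.
move=> P1.
have F0 : factor 0%N = D.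
  rewrite fconstME fcoefD fcoefM big_ord_recl big_ord0 P0.
  by rewrite mul0r !addr0 mulr1.
have F1 : factor 1%N = lconst (lconst p) * (D * G).
  rewrite fconstME fcoefD [fcoef (P * _) _]fcoefM !big_ord_recl big_ord0 P0 mul0r.
  by rewrite /= P1 !add0r addr0 mulrCA.
have -> : value factor 1%N =
    ldiag (factor 1%N + lmap (scaled_deriv hs a) (factor 0%N)).
  by rewrite [LHS]/= invr1 scale1r.
rewrite F0 F1.
have pC : in_Czw (lconst (lconst p) : L2) := in_Czw_lconst _.
have aC : in_Czw (lconst (lconst a * hs^-1)) := in_Czw_lconst _.
rewrite lmap_scaled_deriv dz_diff -rmorphM /= ldiagD //; last first.
  by apply: in_CzwM => //; apply: in_Czw_DG.
rewrite ldiagM //; last exact: in_Czw_DG.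
rewrite ldiag_DG !ldiag_lconst scalerBl addrC mulrN.
by [].
Qed.

(** The logarithmic derivative of the factor is a (G + u + gamma P). The term
    u, which removes the pole of G, is the logarithmic derivative of z - w. *)
Lemma factor_value_eq0 : fderiv P =
    - (fconst (lconst (lconst a)) * (fmap_fps dz P - 1 - fconst gamma * P ^+ 2)) ->
  value factor = 0.
Proof.
move=> P'; have [c d_lt] := scaled_deriv_lt hs a.
have dd := scaled_deriv_der hs a; have dl := scaled_deriv_lconst hs a.
have [tD tM] := total_deriv_der dd.
pose al : fps L2 := fconst (lconst (lconst a)).
have fmapE (F : fps L2) : fmap_fps (lmap (scaled_deriv hs a)) F = al * fmap_fps dz F.
  by apply: fpsP => n; rewrite fconstME /= lmap_scaled_deriv.
have dz0 : dz 0 = 0 := derivation0 (lmap_derivation (deriv_at_der hs)).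
have Dconst v : total_deriv (scaled_deriv hs a) (fconst v) = al * fconst (dz v).
  by rewrite /total_deriv fderiv_const add0r fmapE fmap_fconst.
apply: (@taylor_value_eq0 _ _ dd c d_lt _
  (al * (fconst (G + u) + fconst gamma * P))).
- exact: fps_Czw_factor.
- apply: fps_CzwM; first exact/fps_Czw_const/in_Czw_lconst.
  apply: fps_CzwD; first exact: fps_Czw_const.
  by apply: fps_CzwM => //; apply: fps_Czw_const.
- rewrite /factor tM Dconst dz_diff -Du tD tM Dconst dG.
  rewrite (derivation1 (total_deriv_der dd)).
  have -> : total_deriv (scaled_deriv hs a) P = al * (1 + fconst gamma * P ^+ 2).
    by rewrite /total_deriv fmapE P' -/al; ring.
  rewrite !(rmorphD, rmorphM, rmorphXn) /=; ring.
- by have := factor_value0; rewrite taylor_value_coef0.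
Qed.

Variable E : fps L2.
Hypothesis EC : fps_Czw E.

Lemma product_value_eq0 : fderiv P =
    - (fconst (lconst (lconst a)) * (fmap_fps dz P - 1 - fconst gamma * P ^+ 2)) ->
  value (E * factor) = 0.
Proof.
move=> P'; have [c d_lt] := scaled_deriv_lt hs a.
rewrite (taylor_valueM (scaled_deriv_der hs a) d_lt EC fps_Czw_factor).
by rewrite factor_value_eq0 ?mulr0.
Qed.

(** Only the coefficient of hbar matters: there z - w contributes a / h and
    the term p G (z - w) contributes - p / h. *)
Lemma product_value_neq0 (p : C) : E 0%N = 1 -> P 1%N = lconst (lconst p) ->
  a != p -> value (E * factor) <> 0.
Proof.
move=> E0 P1 ap; have [c d_lt] := scaled_deriv_lt hs a.
rewrite (taylor_valueM (scaled_deriv_der hs a) d_lt EC fps_Czw_factor).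
move=> /(congr1 (fun F => fcoef F 1)).
rewrite fcoefM !big_ord_recl big_ord0 factor_value0 mulr0 !addr0.
have -> : value E 0%N = 1.
  by rewrite taylor_value_coef0 E0 -[1 in LHS]/(lconst 1) ldiag_lconst.
have F1 : value factor 1%N = lconst (a - p) * hs^-1 := factor_value1 P1.
rewrite subn0 F1 mul1r => /eqP; apply/negP.
by rewrite mulf_neq0 ?invr_eq0 // fmorph_eq0 subr_eq0.
Qed.

End DiagonalZeros.

(** * Numerator and denominator of q(z, w) *)

Section Scalars.
Variable C : numFieldType.
Local Notation L2 := (laurent (laurent C)).

Lemma scalar1 : lconst (lconst 1) = 1 :> L2.
Proof. by rewrite (rmorph1 (@lconst C)) (rmorph1 (@lconst (laurent C))). Qed.

Lemma scalarN1 : lconst (lconst (- 1)) = - 1 :> L2.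
Proof. by rewrite (rmorphN1 (@lconst C)) (rmorphN1 (@lconst (laurent C))). Qed.

End Scalars.

Section Substitution.
Variables (C : numFieldType) (hs : laurent C).
Local Notation L2 := (laurent (laurent C)).

Lemma in_Czw_poly_value (f : {rmorphism C -> L2}) (X : nat -> L2) p :
  (forall c, in_Czw (f c)) -> (forall i, in_Czw (X i)) ->
  in_Czw (poly_value f X p).
Proof.
move=> fC XC; apply: in_Czw_sum => m; apply: in_CzwM => //.
by apply: big_ind => [||i _]; [exact: in_Czw1|exact: in_CzwM|exact: in_CzwX].
Qed.

Local Notation dz := (lmap (deriv_at hs) : L2 -> L2).
Variable g : L2.
Hypothesis gC : in_Czw g.

Lemma in_Czw_iter i : in_Czw (iter i dz g).
Proof.
elim: i => //= i [N iN].
have [c d_lt] := scaled_deriv_lt hs 1; exists (N - c%:Z) => n m mN.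
rewrite lmapE; last exact: derivation0 (deriv_at_der hs).
rewrite -[deriv_at _ _]scale1r; apply: d_lt mN => k; exact: iN.
Qed.

Lemma gevalE p : geval hs g p =
  poly_value (@lconst (laurent C) \o @lconst C) (fun i => iter i dz g) p.
Proof. by []. Qed.

Lemma in_Czw_geval p : in_Czw (geval hs g p).
Proof.
rewrite gevalE; apply: in_Czw_poly_value => [c|i]; first exact: in_Czw_lconst.
exact: in_Czw_iter.
Qed.

Lemma psi_plus_equation psi : is_psi psi -> let P := psi_plus hs g psi in
  fderiv P = fmap_fps dz P - 1 - fconst g * P ^+ 2.
Proof.
have dd := lmap_derivation (deriv_at_der hs).
have d0 := derivation0 (deriv_at_der hs).
apply: (fmap_poly_value_psi (f := @lconst (laurent C) \o @lconst C)
  (X := fun i => iter i dz g) dd) => // c /=.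
by rewrite lmap_lconst // deriv_at_lconst raddf0.
Qed.

Lemma psi_plus0 psi : is_psi psi -> psi_plus hs g psi 0%N = 0.
Proof. by move=> [psi0 _]; rewrite /= psi0 gevalE poly_value0. Qed.

Lemma psi_plus1 psi : is_psi psi ->
  psi_plus hs g psi 1%N = lconst (lconst (- 1)).
Proof.
move=> psiP; set P := psi_plus hs g psi.
have -> : P 1%N = fderiv P 0%N by [].
rewrite psi_plus_equation // !fcoefB fconstME expr2 fcoefM big_ord_recl big_ord0.
rewrite psi_plus0 // mul0r !addr0 mulr0 subr0.
have -> : fmap_fps dz P 0%N = 0.
  rewrite /= psiP.1 gevalE poly_value0.
  exact: derivation0 (lmap_derivation (deriv_at_der hs)).
by rewrite sub0r scalarN1.
Qed.

Lemma fps_Czw_psi_plus psi : fps_Czw (psi_plus hs g psi).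
Proof. by move=> n; apply: in_Czw_geval. Qed.

Lemma fps_Czw_phi varphi : fps_Czw (phi_series hs g varphi).
Proof.
apply: fps_CzwM; first exact/fps_Czw_const/in_Czw_natV.
move=> n; apply: in_CzwD; first exact: in_Czw_geval.
by apply: in_CzwN; apply: fps_Czw_compN => k; apply: in_Czw_geval.
Qed.

End Substitution.

Section CompN.
Variable A : comNzRingType.
Implicit Types u v : fps A.

Lemma fcompNM u v : fcompN (u * v) = fcompN u * fcompN v.
Proof.
apply: fpsP => n; rewrite fcoefM.
have -> : fcompN (u * v) n = (-1) ^+ n * (u * v) n by [].
rewrite fcoefM mulr_sumr; apply: eq_bigr => i _ /=.
by rewrite mulrACA -exprD subnKC // -ltnS.
Qed.

Lemma fcompND u v : fcompN (u + v) = fcompN u + fcompN v.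
Proof. by apply: fpsP => n /=; rewrite mulrDr. Qed.

Lemma fcompNN u : fcompN (- u) = - fcompN u.
Proof. by apply: fpsP => n /=; rewrite mulrN. Qed.

Lemma fcompN_const (a : A) : fcompN (fconst a) = fconst a.
Proof. by apply: fpsP => -[|n] /=; rewrite ?mul1r ?mulr0. Qed.

Lemma fcompN1 : fcompN (1 : fps A) = 1.
Proof. exact: fcompN_const. Qed.

Lemma fderiv_compN u : fderiv (fcompN u) = - fcompN (fderiv u).
Proof.
by apply: fpsP => n /=; rewrite exprS mulN1r mulNr mulNrn mulrnAr.
Qed.

Lemma fmap_compN (d : A -> A) u : is_derivation d ->
  fmap_fps d (fcompN u) = fcompN (fmap_fps d u).
Proof.
move=> dd; apply: fpsP => n /=.
by rewrite -signr_odd; case: odd; rewrite ?mul1r // !mulN1r derivationN.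
Qed.

End CompN.

Section Result.
Variables (C : numFieldType) (I : finType) (h : I -> laurent C) (s : I).
Local Notation L2 := (laurent (laurent C)).
Local Notation hs := (h s).
Local Notation D := (diff_zw C).
Local Notation dz := (lmap (deriv_at hs) : L2 -> L2).
Variables (G gamma : L2).
Hypothesis hs_neq0 : hs != 0.
Hypothesis GC : in_Czw (G + cauchy_kernel hs).
Hypothesis gammaC : in_Czw gamma.
Hypothesis dG : dz G = gamma + G ^+ 2.
Variables (psi varphi : fps (gpoly C)) (tau : fps L2).
Hypothesis psiP : is_psi psi.
Hypothesis tauC : fps_Czw tau.

Local Notation P := (psi_plus hs gamma psi).
Local Notation N := (psi_minus hs gamma psi).
Local Notation num := (q_num hs gamma psi varphi tau G).
Local Notation den := (q_den hs gamma psi G).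

Let Du := diff_cauchy_kernel hs.

Let NC : fps_Czw N := fps_Czw_compN (fps_Czw_psi_plus hs gammaC psi).

Lemma denE : den = 1 * factor G N. Proof. by rewrite mul1r. Qed.

Definition prefactor : fps L2 :=
  fexp (2 * fX _ * (tau - phi_series hs gamma varphi)).

Lemma numE : num = prefactor * factor G P. Proof. by rewrite /factor mulrA. Qed.

Lemma fps_Czw_prefactor : fps_Czw prefactor.
Proof.
apply/fps_Czw_exp/fps_CzwM.
  apply: fps_CzwM; last exact: fps_Czw_X.
  by rewrite -[2]/(1 + 1); apply: fps_CzwD; apply: fps_Czw1.
by apply: fps_CzwD => //; apply: fps_CzwN; apply: fps_Czw_phi.
Qed.

Lemma fps_Czw_den : fps_Czw den.
Proof. exact: (fps_Czw_factor Du). Qed.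

Lemma fps_Czw_num : fps_Czw num.
Proof.
rewrite numE; apply: fps_CzwM; first exact: fps_Czw_prefactor.
by apply: (fps_Czw_factor Du) => //; apply: fps_Czw_psi_plus.
Qed.

Lemma psi_minus0 : N 0%N = 0.
Proof.
have -> : N 0%N = (- 1) ^+ 0 * P 0%N by [].
by rewrite psi_plus0 // mulr0.
Qed.

Lemma psi_minus1 : N 1%N = lconst (lconst 1).
Proof.
have -> : N 1%N = (- 1) ^+ 1 * P 1%N by [].
by rewrite psi_plus1 // scalarN1 scalar1 expr1 mulrNN mulr1.
Qed.

(** The sign of the equation for psi changes with hbar, to match the opposite
    direction of the flow in the denominator. *)
Lemma psi_minus_equation :
  fderiv N = - (fmap_fps dz N - 1 - fconst gamma * N ^+ 2).
Proof.
rewrite fderiv_compN psi_plus_equation //.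
rewrite fmap_compN; last exact/lmap_derivation/deriv_at_der.
by rewrite expr2 !(fcompND, fcompNN, fcompNM, fcompN_const, fcompN1).
Qed.

Lemma value_at_exp_coordinate a F : fps_Czw F ->
  value_at F (exp_coordinate h a s) (taylor_value (scaled_deriv hs a) F).
Proof.
have [c d_lt] := scaled_deriv_lt hs a.
rewrite -flow_exp_coordinate; apply: (taylor_valueP _ _ d_lt).
  exact: scaled_deriv_der.
exact: scaled_deriv_lconst.
Qed.

Lemma num_value_eq0 : taylor_value (scaled_deriv hs (- 1)) num = 0.
Proof.
rewrite numE; apply: (product_value_eq0 Du GC dG gammaC).
- exact: fps_Czw_psi_plus.
- exact: psi_plus0.
- exact: fps_Czw_prefactor.
by rewrite scalarN1 (rmorphN1 (@fconst L2)) mulN1r opprK; apply: psi_plus_equation.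
Qed.

Lemma den_value_eq0 : taylor_value (scaled_deriv hs 1) den = 0.
Proof.
rewrite denE; apply: (product_value_eq0 Du GC dG gammaC NC psi_minus0).
  exact: fps_Czw1.
by rewrite scalar1 (rmorph1 (@fconst L2)) mul1r; apply: psi_minus_equation.
Qed.

Lemma den_value_neq0 : taylor_value (scaled_deriv hs (- 1)) den <> 0.
Proof.
rewrite denE; apply: (product_value_neq0 hs_neq0 Du GC NC psi_minus0 _ _ psi_minus1).
- exact: fps_Czw1.
- by [].
by rewrite -subr_eq0 -opprD oppr_eq0 -[1 + 1]/2%:R pnatr_eq0.
Qed.

Lemma num_value_neq0 : taylor_value (scaled_deriv hs 1) num <> 0.
Proof.
have PC := fps_Czw_psi_plus hs gammaC psi; have P0 := psi_plus0 hs gamma psiP.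
rewrite numE.
apply: (product_value_neq0 hs_neq0 Du GC PC P0 _ _ (psi_plus1 hs gamma psiP)).
- exact: fps_Czw_prefactor.
- by rewrite /= big_ord_recl big_ord0 addr0 expr0 fact0 divr1.
by rewrite -subr_eq0 opprK -[1 + 1]/2%:R pnatr_eq0.
Qed.

(** Both signs of the flow are instances of the same two facts: a factor whose
    equation matches the direction of the flow has value 0, and the other one
    does not, as its coefficient of hbar is a nonzero multiple of h^-1. *)
Theorem diagonal_values :
  [/\ forall n, in_Czw (num n),
      forall n, in_Czw (den n),
      quotient_at num den (exp_coordinate h (- 1) s) 0 &
      quotient_at den num (exp_coordinate h 1 s) 0].
Proof.
have [numC denC] := (fps_Czw_num, fps_Czw_den).
have lau0 : lau_of_fps 0 = 0 :> laurent (laurent C) by exact: raddf0.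
split; [exact: numC | exact: denC | |].
- exists (taylor_value (scaled_deriv hs (- 1)) num).
  exists (taylor_value (scaled_deriv hs (- 1)) den).
  split; try exact: value_at_exp_coordinate; first exact: den_value_neq0.
  by rewrite num_value_eq0 lau0 mul0r.
- exists (taylor_value (scaled_deriv hs 1) den).
  exists (taylor_value (scaled_deriv hs 1) num).
  split; try exact: value_at_exp_coordinate; first exact: num_value_neq0.
  by rewrite den_value_eq0 lau0 mul0r.
Qed.

End Result.

Unset Implicit Arguments.

Theorem corollary1p1 (R : realType) (X : topologicalType)
  (M : riemann_surface R[i] X)
  (X_hausdorff : hausdorff_space X)
  (X_compact : compact [set: X])
  (X_connected : connected [set: X])
  (omega : mero_differential M)
  (omega_neq0 : nonzero_differential omega)
  (S : {fset X})
  (S_zeros_poles : forall x,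
    zero_of_differential omega x \/ pole_of_differential omega x -> x \in S)
  (zc : S -> chart R[i] X) (zc_coordinates : local_coordinates M zc)
  (h : S -> laurent R[i]) (h_omega : differential_expansion omega zc h)
  (Lambda : set (S -> laurent R[i]))
  (Lambda_maximal_isotropic : maximal_isotropic h Lambda)
  (Lambda_complement : complement (functions_regular_outside M zc) Lambda)
  (Lambda_commensurable : commensurable Lambda (@integral_K _ _))
  (eR eL : nat -> S -> laurent R[i])
  (eR_basis : linear_basis (functions_regular_outside M zc) eR)
  (eL_basis : topological_basis Lambda eL)
  (e_dual : forall i j, pairing h (eR i) (eL j) = - (i == j)%:R)
  (eL_cvg0 : K_cvg eL 0)
  (G : S -> S -> laurent (laurent R[i])) (G_sum : is_tensor_sum eR eL G)
  (gamma : S -> S -> laurent (laurent R[i]))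
  (gammaE : forall s t, gamma s t = lmap (deriv_at (h s)) (G s t) - G s t ^+ 2)
  (gamma_RR : in_tensor_square (functions_regular_outside M zc) gamma)
  (psi varphi : fps (gpoly R[i]))
  (psiP : is_psi psi) (varphiP : is_varphi psi varphi)
  (tau : S -> S -> fps (laurent (laurent R[i])))
  (tau_RR : forall n, in_tensor_square (functions_regular_outside M zc)
                        (fun s t => tau s t n))
  (tauP : forall s t n,
    adic_cvg
      (fun k => \sum_(i < k) (tensor (sinh_op h (eR i) s n) (eL i t) -
                              tensor (eR i s) (sinh_op h (eL i) t n)))
      (tau s t n + lswap (tau t s n)))
  (s : S) :
  let num := q_num (h s) (gamma s s) psi varphi (tau s s) (G s s) in
  let den := q_den (h s) (gamma s s) psi (G s s) in
  [/\ forall n, in_Czw (num n),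
      forall n, in_Czw (den n),
      quotient_at num den (exp_coordinate h (- 1) s) 0 &
      quotient_at den num (exp_coordinate h 1 s) 0].
Proof.
have [[_ _] Lambda_iso _] := Lambda_maximal_isotropic.
have [M0 LM] := poles_bounded Lambda_commensurable.1.
have hs_neq0 := weight_neq0 s Lambda_maximal_isotropic LM.
have [eL_Lambda _ _] := eL_basis.
have GC := in_Czw_kernel eR_basis eL_Lambda Lambda_iso e_dual Lambda_complement
  G_sum LM hs_neq0.
have gammaC : in_Czw (gamma s s) := in_Czw_tensor_square s s gamma_RR.
have dG : lmap (deriv_at (h s)) (G s s) = gamma s s + G s s ^+ 2.
  by rewrite gammaE subrK.
have tauC : fps_Czw (tau s s) := fun n => in_Czw_tensor_square s s (tau_RR n).
move=> num den.
exact: (diagonal_values hs_neq0 GC gammaC dG varphi psiP tauC).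
Qed.
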